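(* Let $T$ be a triangulation of a square, and let $w\in V(T)$ be a point of its area variety. Then either $w$ is in the image of the area map of $T$, or there is a subset of the coordinates of $w$, not all of which are $0$, that sums to $0$.
   Context: A triangulation $T$ (of a square) is an oriented simplicial complex homeomorphic to a closed disk with exactly four vertices on its boundary; these are the corners, labeled $\mathbf{p},\mathbf{q},\mathbf{r},\mathbf{s}$ in the cyclic order determined by the orientation. Let $\Delta_1,\dots,\Delta_n$ be the triangles (2-cells) of $T$, each with the orientation inherited from $T$. A drawing of $T$ is a map $\rho$ from the vertex set of $T$ to $\mathbb{C}^2$ with $\rho(\mathbf{p})+\rho(\mathbf{r})=\rho(\mathbf{q})+\rho(\mathbf{s})$; $X(T)$ is the space of all drawings. For points $p_i=(x_i,y_i)\in\mathbb{C}^2$, $\mathrm{Area}(p_1p_2p_3)=\frac12\det\begin{pmatrix}1&1&1\\ x_1&x_2&x_3\\ y_1&y_2&y_3\end{pmatrix}$, and $\mathrm{Area}_i(\rho)$ is the area of the image under $\rho$ of the (positively ordered) vertices of $\Delta_i$. Let $Y(T)=\mathbb{P}^{n-1}(\mathbb{C})$ with homogeneous coordinates $A_1,\dots,A_n$, one for each triangle. The area map is the rational map $\mathrm{Area}:X(T)\dashrightarrow Y(T)$, $\rho\mapsto[\mathrm{Area}_1(\rho):\dots:\mathrm{Area}_n(\rho)]$; its image is the set of points $\mathrm{Area}(\rho)$ for drawings $\rho$ with not all $\mathrm{Area}_i(\rho)$ equal to $0$. The area variety $V(T)$ is the closure of the image of the area map in $Y(T)$. *)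

(* Defs.v *)
From HB Require Import structures.
From mathcomp Require Import all_boot all_order all_algebra.
From mathcomp Require Import complex.
From mathcomp Require Import boolp classical_sets reals.
From mathcomp Require mpoly.

Set Implicit Arguments.
Unset Strict Implicit.
Unset Printing Implicit Defensive.

Import Order.TTheory GRing.Theory Num.Theory.

(* The notations of mpoly clash with those of topology, hence the module. *)
Module ProjZariski.
Import mpoly.
Local Open Scope classical_set_scope.
Local Open Scope ring_scope.

(* Points of P^(n-1) are represented by nonzero vectors of homogeneous
   coordinates, and sets of points by the sets of all their representatives. *)
Definition proj_zariski_closed (F : fieldType) (n : nat) (Z : set 'rV[F]_n) :
    Prop :=
  exists S : set {mpoly F[n]},
    (forall f, S f -> exists d : nat, f \is d.-homog) /\
    Z = [set w : 'rV[F]_n | w != 0 /\ forall f, S f -> f.@[w 0] = 0].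

Definition proj_zariski_closure (F : fieldType) (n : nat) (A : set 'rV[F]_n) :
    set 'rV[F]_n :=
  [set w | forall Z, proj_zariski_closed Z -> A `<=` Z -> Z w].

End ProjZariski.
Export ProjZariski.

From mathcomp Require Import topology normedtype.
Import numFieldNormedType.Exports.

Local Open Scope classical_set_scope.
Local Open Scope ring_scope.
Local Open Scope complex_scope.

(* The vertex set is all of 'I_m. *)
Record simplicial_complex (m : nat) := SimplicialComplex {
  faces :> {set {set 'I_m}};
  faces_neq0 : forall s : {set 'I_m}, s \in faces -> s != finset.set0;
  faces_vertex : forall v : 'I_m, [set v]%SET \in faces;
  faces_sub : forall s t : {set 'I_m},
    s \in faces -> t \subset s -> t != finset.set0 -> t \in faces
}.

(* Points are given by their barycentric coordinates. *)
Definition realization (R : realType) (m : nat) (K : simplicial_complex m) :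
    set 'rV[R]_m :=
  [set x | [/\ forall v, 0 <= x 0 v, \sum_v x 0 v = 1 &
               [set v | x 0 v != 0]%SET \in faces K]].

Definition closed_disk (R : realType) : set (R * R) :=
  [set z | z.1 ^+ 2 + z.2 ^+ 2 <= 1].

Definition homeomorphic (X Y : topologicalType) (A : set X) (B : set Y) : Prop :=
  exists (f : X -> Y) (g : Y -> X),
    [/\ {within A, continuous f} /\ {within B, continuous g},
        forall x, A x -> B (f x), forall y, B y -> A (g y),
        forall x, A x -> g (f x) = x & forall y, B y -> f (g y) = y].

(* Oriented triangles Delta_i are given by Delta i 0, Delta i 1, Delta i 2, the
   vertices in positive order (only their cyclic order matters); ordS is the
   cyclic successor on 'I_3. *)
Definition triangle (m n : nat) (Delta : 'I_n -> 'I_3 -> 'I_m) (i : 'I_n) :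
    {set 'I_m} :=
  [set Delta i k | k in 'I_3]%SET.

Definition arc (m n : nat) (Delta : 'I_n -> 'I_3 -> 'I_m) (i : 'I_n)
    (u v : 'I_m) : Prop :=
  exists k : 'I_3, Delta i k = u /\ Delta i (ordS k) = v.

(* The boundary edges are the edges lying in exactly one triangle, directed as
   in that triangle. *)
Definition boundary_arc (m n : nat) (Delta : 'I_n -> 'I_3 -> 'I_m)
    (u v : 'I_m) : Prop :=
  exists2 i, arc Delta i u v &
    forall j, u \in triangle Delta j -> v \in triangle Delta j -> j = i.

(* That the complex is pure of dimension 2 follows from [T_disk]. *)
Record square_triangulation (R : realType) (m n : nat) := SquareTriangulation {
  T_complex : simplicial_complex m;
  T_disk : homeomorphic (realization (R := R) T_complex) (@closed_disk R);
  Delta : 'I_n -> 'I_3 -> 'I_m;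
  Delta_inj : injective (triangle Delta);
  DeltaP : forall s : {set 'I_m},
    (s \in faces T_complex /\ #|s| = 3%N) <-> (exists i, s = triangle Delta i);
  (* two triangles sharing an edge induce opposite directions on it *)
  Delta_coherent : forall (u v : 'I_m) (i j : 'I_n),
    arc Delta i u v -> arc Delta j u v -> i = j;
  cp : 'I_m; cq : 'I_m; cr : 'I_m; cs : 'I_m;
  (* the boundary is the directed 4-cycle p, q, r, s: this gives both the four
     boundary vertices and their cyclic order *)
  corners_uniq : uniq [:: cp; cq; cr; cs];
  boundaryP : forall u v : 'I_m,
    boundary_arc Delta u v <->
    (u, v) \in [:: (cp, cq); (cq, cr); (cr, cs); (cs, cp)]
}.

Definition drawing (R : realType) (m n : nat) (T : square_triangulation R m n)
    (rho : 'I_m -> R[i] * R[i]) : Prop :=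
  rho (cp T) + rho (cr T) = rho (cq T) + rho (cs T).

Definition area (R : realType) (P : 'I_3 -> R[i] * R[i]) : R[i] :=
  2^-1 * \det (\matrix_(a < 3, k < 3)
    (if a == 0 then 1 else if a == 1 then (P k).1 else (P k).2)).

Definition area_vec (R : realType) (m n : nat) (T : square_triangulation R m n)
    (rho : 'I_m -> R[i] * R[i]) : 'rV[R[i]]_n :=
  \row_i area (fun k => rho (Delta T i k)).

Definition area_image (R : realType) (m n : nat)
    (T : square_triangulation R m n) : set 'rV[R[i]]_n :=
  [set w | w != 0 /\
    exists rho, drawing T rho /\
      exists2 c : R[i], c != 0 & w = c *: area_vec T rho].

Definition area_variety (R : realType) (m n : nat)
    (T : square_triangulation R m n) : set 'rV[R[i]]_n :=
  proj_zariski_closure (area_image T).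

(* Main.v *)
Require Import Defs.
From mathcomp Require Import all_boot all_order all_algebra.
From mathcomp Require Import complex.
From mathcomp Require Import boolp classical_sets reals.
From mathcomp Require mpoly topology normedtype.
From mathcomp Require Import ring lra.

Set Implicit Arguments.
Unset Strict Implicit.
Unset Printing Implicit Defensive.

Import Order.TTheory GRing.Theory Num.Theory.
Local Open Scope ring_scope.
Local Open Scope complex_scope.

(** Suppose that the coordinates of [w] do not sum to [0]; otherwise all of
    them together form the required subset.  Drawings with a nondegenerate
    parallelogram can be normalized by an affine change of coordinates so that
    the corners become the unit square.  Work with the generic such drawing,
    over the field [K] of rational functions in the coordinates of the vertices.
    That [w] lies in the closure of the image says that every polynomial
    relation between the generic areas holds for [w], rescaled to the area of
    the unit square ([generic_relation]); hence there is a ring morphism from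
    the algebra of the generic areas to the complex numbers with values [w], and
    it extends to a place of [K] ([place_extension]).  The place sends every
    vertex to a limit point of the projective plane, either finite or at
    infinity, and clearing denominators in the area determinant gives
    ([limit_drawing]): a triangle with three finite limits has the area
    prescribed by [w], and a triangle with a limit at infinity has collinear
    limits.

    Let the core be the set of vertices joined to the corners through finite
    vertices.  An edge that leaves the core ends at infinity.  Cross such an
    edge and turn around its end points: since the triangles met on the way have
    collinear limits, the line through the two limits never changes.  The edges
    between the core and one connected piece [U] of its complement might a
    priori be met in several such turns, with different lines, but the edges of
    [U] belonging to one line form a cocycle modulo 2, which is a coboundary
    because a disk has no first cohomology ([disk_cohomology]).  As the core and
    [U] are connected, the cocycle contains all edges between them or none, so
    all vertices of the core adjacent to [U] lie on one affine line
    ([component_line]).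

    Redraw: keep the finite limits in the core, and collapse every piece to one
    of its neighbours in the core.  Triangles inside the core keep the area given
    by [w], all others become degenerate ([redraw_area]).  The total area of a
    drawing is determined by its corners ([area2_sum]), so the coordinates of
    [w] on the collapsed triangles sum to [0].  If one of them is nonzero, this
    is the required subset; otherwise the new drawing has area vector [w] up to
    scaling. *)

(** * Extension of places *)

Section Places.
Local Open Scope classical_set_scope.
Variables (K : fieldType) (L : closedFieldType).
Implicit Types (G : set (K * L)) (x a : K) (y b : L) (p : {poly K}) (q : {poly L}).

(** A ring morphism to [L] from a subring of [K], given by its graph: a subring
    of the product that is the graph of a function.  In this form the union of a
    chain is immediate. *)
Definition partial_morphism G : Prop :=
  [/\ G (1, 1),
      forall a b a' b', G (a, b) -> G (a', b') -> G (a - a', b - b'),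
      forall a b a' b', G (a, b) -> G (a', b') -> G (a * a', b * b') &
      forall b, G (0, b) -> b = 0].

Section PartialMorphism.
Variable G : set (K * L).
Hypothesis hG : partial_morphism G.

Lemma pm1 : G (1, 1). Proof. by case: hG. Qed.
Lemma pmB a b a' b' : G (a, b) -> G (a', b') -> G (a - a', b - b').
Proof. by case: hG => _ + _ _; apply. Qed.
Lemma pmM a b a' b' : G (a, b) -> G (a', b') -> G (a * a', b * b').
Proof. by case: hG => _ _ + _; apply. Qed.
Lemma pm_ker b : G (0, b) -> b = 0. Proof. by case: hG => _ _ _; apply. Qed.
Lemma pm0 : G (0, 0). Proof. by have := pmB pm1 pm1; rewrite !subrr. Qed.
Lemma pmN a b : G (a, b) -> G (- a, - b).
Proof. by move=> /(pmB pm0); rewrite !sub0r. Qed.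
Lemma pmD a b a' b' : G (a, b) -> G (a', b') -> G (a + a', b + b').
Proof. by move=> h /pmN /(pmB h); rewrite !opprK. Qed.
Lemma pm_fun a b b' : G (a, b) -> G (a, b') -> b = b'.
Proof.
by move=> h /(pmB h); rewrite subrr => /pm_ker/eqP; rewrite subr_eq0 => /eqP.
Qed.
Lemma pm_sum (I : Type) (r : seq I) (A : I -> K) (B : I -> L) :
  (forall i, G (A i, B i)) -> G (\sum_(i <- r) A i, \sum_(i <- r) B i).
Proof.
move=> h; apply: (big_rec2 (fun b a => G (a, b))); first exact: pm0.
by move=> i y1 y2 _; apply: pmD.
Qed.

(** The graph of the induced partial morphism between polynomial rings. *)
Definition poly_graph p q := forall i, G (p`_i, q`_i).

Lemma poly_graphC a b : G (a, b) -> poly_graph a%:P b%:P.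
Proof. by move=> h i; rewrite !coefC; case: ifP => // _; apply: pm0. Qed.
Lemma poly_graphB p q p' q' :
  poly_graph p q -> poly_graph p' q' -> poly_graph (p - p') (q - q').
Proof. by move=> h h' i; rewrite !coefB; apply: pmB. Qed.
Lemma poly_graphM p q p' q' :
  poly_graph p q -> poly_graph p' q' -> poly_graph (p * p') (q * q').
Proof. by move=> h h' i; rewrite !coefM; apply: pm_sum => j; apply: pmM. Qed.
Lemma poly_graphXn n : poly_graph 'X^n 'X^n.
Proof. by move=> i; rewrite !coefXn; case: eqP => _; [apply: pm1|apply: pm0]. Qed.
Lemma poly_graphZ a b p q :
  G (a, b) -> poly_graph p q -> poly_graph (a *: p) (b *: q).
Proof. by move=> h h' i; rewrite !coefZ; apply: pmM. Qed.

(** The graph generated by [G] and the pair [(x, y)], that is the extension of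
    the morphism that sends [x] to [y]. *)
Definition adjoin x y : set (K * L) :=
  [set ab | exists p q, [/\ poly_graph p q, p.[x] = ab.1 & q.[y] = ab.2]].

Lemma sub_adjoin x y : G `<=` adjoin x y.
Proof.
by move=> [a b] h; exists a%:P, b%:P; rewrite /= !hornerC; split => //; apply: poly_graphC.
Qed.

Lemma mem_adjoin x y : adjoin x y (x, y).
Proof.
exists 'X, 'X; rewrite /= !hornerX; split => //.
by rewrite -[X in poly_graph X]expr1 -[X in poly_graph _ X]expr1; apply: poly_graphXn.
Qed.

Lemma adjoin_partial_morphism x y :
  (forall p q, poly_graph p q -> p.[x] = 0 -> q.[y] = 0) ->
  partial_morphism (adjoin x y).
Proof.
move=> h; split.
- exact/sub_adjoin/pm1.
- move=> _ _ _ _ [p [q [h1 /= <- <-]]] [p' [q' [h2 /= <- <-]]].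
  by exists (p - p'), (q - q'); rewrite !hornerD !hornerN; split=> //; apply: poly_graphB.
- move=> _ _ _ _ [p [q [h1 /= <- <-]]] [p' [q' [h2 /= <- <-]]].
  by exists (p * p'), (q * q'); rewrite !hornerM; split=> //; apply: poly_graphM.
- by move=> b [p [q [h1 /= hp <-]]]; apply: h hp.
Qed.

(** The extension of the morphism to the localization of its domain at its
    kernel. *)
Definition localize : set (K * L) :=
  [set ab | exists u v c d, [/\ G (u, v), G (c, d), d != 0,
     ab.1 = u / c & ab.2 = v / d]].

Lemma pm_neq0 a b : G (a, b) -> b != 0 -> a != 0.
Proof.
move=> h; apply: contra => /eqP a0; move: h; rewrite a0 => /pm_ker ->.
by rewrite eqxx.
Qed.

Lemma sub_localize : G `<=` localize.
Proof.
move=> [a b] h; exists a, b, 1, 1; rewrite /= !divr1 oner_neq0.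
by split => //; apply: pm1.
Qed.

Lemma localize_partial_morphism : partial_morphism localize.
Proof.
split.
- exact/sub_localize/pm1.
- move=> _ _ _ _ [u [v [c [d [h1 h2 d0 /= -> ->]]]]] [u' [v' [c' [d' [h1' h2' d0' /= -> ->]]]]].
  have c0 := pm_neq0 h2 d0; have c0' := pm_neq0 h2' d0'.
  exists (u * c' - u' * c), (v * d' - v' * d), (c * c'), (d * d').
  split.
  + by apply: pmB; apply: pmM.
  + exact: pmM.
  + exact: mulf_neq0.
  + by rewrite /=; field; rewrite c0' c0.
  + by rewrite /=; field; rewrite d0 d0'.
- move=> _ _ _ _ [u [v [c [d [h1 h2 d0 /= -> ->]]]]] [u' [v' [c' [d' [h1' h2' d0' /= -> ->]]]]].
  exists (u * u'), (v * v'), (c * c'), (d * d').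
  split; [exact: pmM | exact: pmM | exact: mulf_neq0 | |];
    by rewrite /= invfM mulrACA.
- move=> b [u [v [c [d [h1 h2 d0 /= h0 ->]]]]].
  have c0 := pm_neq0 h2 d0.
  have u0 : u = 0 by apply: (mulIf (invr_neq0 c0)); rewrite mul0r.
  by rewrite u0 in h1; rewrite (pm_ker h1) mul0r.
Qed.

End PartialMorphism.

Section Maximal.
Variable G : set (K * L).
Hypothesis hG : partial_morphism G.
Hypothesis maxG : forall G', partial_morphism G' -> G `<=` G' -> G' `<=` G.

(** By maximality a partial morphism is defined on the localization at its
    kernel; hence its domain is local and its image is a field. *)
Lemma max_inv a b : G (a, b) -> b != 0 -> G (a^-1, b^-1).
Proof.
move=> h b0; apply: (maxG (localize_partial_morphism hG)); first exact: sub_localize.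
by exists 1, 1, a, b; rewrite /= !div1r; split => //; apply: pm1.
Qed.

(** The images of the polynomials over the domain that vanish at [x] form an
    ideal of the polynomials over the image, which is a field.  If the ideal is
    proper, it has a root [y] in the algebraically closed field [L], and [x] can
    be sent to [y].  Thus [x] remains outside of the domain only if the ideal
    contains [1]. *)
Lemma max_relation x : (forall y, ~ G (x, y)) ->
  exists2 p, poly_graph G p 1 & p.[x] = 0.
Proof.
move=> hx.
pose J q := exists2 p, poly_graph G p q & p.[x] = 0.
have JB q q' : J q -> J q' -> J (q - q').
  move=> [p h hp] [p' h' hp']; exists (p - p'); first exact: poly_graphB.
  by rewrite hornerD hornerN hp hp' subr0.
have JZ a b q : G (a, b) -> J q -> J (b *: q).
  move=> h [p h' hp]; exists (a *: p); first exact: poly_graphZ.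
  by rewrite hornerZ hp mulr0.
have JX n q : J q -> J ('X^n * q).
  move=> [p h hp]; exists ('X^n * p); last by rewrite hornerM hp mulr0.
  by apply: poly_graphM => //; apply: poly_graphXn.
have Jcoef q i : J q -> exists a, G (a, q`_i) by move=> [p h _]; exists p`_i.
have noroot y : exists2 q, J q & q.[y] != 0.
  apply: contrapT => hno; apply: (hx y).
  have hpm : partial_morphism (adjoin G x y).
    apply: adjoin_partial_morphism => // p q hpq hp.
    by apply/eqP/negPn/negP => hq; apply: hno; exists q => //; exists p.
  by apply: (maxG hpm); [apply: sub_adjoin | apply: mem_adjoin].
have [q1 Jq1 q1_neq0] := noroot 0.
(* The monic polynomial of least degree in the ideal generates it. *)
have ex : exists n, `[< exists2 q, J q & q != 0 /\ size q = n >].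
  exists (size q1); apply/asboolP; exists q1 => //; split => //.
  by apply: contra q1_neq0 => /eqP ->; rewrite horner0.
case: (ex_minnP ex) => n /asboolP[q0 Jq0 [q0_neq0 sq0]] nmin.
pose q := (lead_coef q0)^-1 *: q0.
have lc0 : lead_coef q0 != 0 by rewrite lead_coef_eq0.
have Jq : J q.
  by have [a ha] := Jcoef _ (size q0).-1 Jq0; apply: JZ Jq0; apply: max_inv ha _.
have sq : size q = n by rewrite size_scale ?invr_neq0.
have mq : q \is monic by rewrite monicE lead_coefZ mulVf.
have n_gt0 : (0 < n)%N by rewrite -sq0 size_poly_gt0.
have div r : J r -> exists r', r = r' * q.
  have [k] := ubnP (size r); elim: k r => // k IH r hr Jr.
  have [->|r0] := eqVneq r 0; first by exists 0; rewrite mul0r.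
  have nr : (n <= size r)%N by apply: nmin; apply/asboolP; exists r.
  pose t := lead_coef r *: ('X^(size r - n) * q).
  have lt : lead_coef t = lead_coef r.
    by rewrite lead_coefZ lead_coef_Mmonic // lead_coefXn mulr1.
  have st : size t = size r.
    rewrite size_scale ?lead_coef_eq0 // size_Mmonic ?monic_neq0 ?monicXn //.
    by rewrite size_polyXn sq addSn subnK.
  have Jt : J t.
    have [a ha] := Jcoef _ (size r).-1 Jr.
    by apply: (JZ a) => //; apply: JX.
  have [|r' hr'] := IH (r - t) _ (JB _ _ Jr Jt).
    rewrite -ltnS; apply: leq_trans hr; rewrite ltnS.
    apply: (leq_ltn_trans (n := (size r).-1)); last first.
      by rewrite prednK // size_poly_gt0.
    apply/leq_sizeP => j hj; rewrite coefB.
    move: hj; rewrite leq_eqVlt => /orP[/eqP<-|hj].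
      by rewrite -{2}st -!lead_coefE lt subrr.
    have {}hj : (size r <= j)%N by move: hj; rewrite prednK ?size_poly_gt0.
    by rewrite !nth_default ?subrr ?st.
  exists (r' + lead_coef r *: 'X^(size r - n)).
  by rewrite mulrDl -hr' -scalerAl subrK.
have [s1|sn1] := eqVneq (size q) 1%N.
  have -> // : (1 : {poly L}) = q.
  rewrite [q]size1_polyC ?s1 //; congr _%:P.
  by move: mq; rewrite monicE lead_coefE s1 => /eqP.
have /closed_rootP[y /rootP hy] := sn1.
have [r /div[r' ->]] := noroot y.
by rewrite hornerM hy mulr0 eqxx.
Qed.

(** The descent behind the valuation property: a relation [p] for [x] and a
    relation [p'] for [x^-1], both congruent to [1] modulo the kernel, let one
    cancel the leading term of the longer by the reversal of the shorter.  The
    correction has coefficients in the kernel, so the result is a shorter relation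
    of the same kind. *)
Lemma no_double_relation x p p' : x != 0 -> poly_graph G p 1 -> p.[x] = 0 ->
  poly_graph G p' 1 -> p'.[x^-1] = 0 -> False.
Proof.
have [k] := ubnP (size p + size p')%N.
elim: k x p p' => // k IH x p p' hk x0 hp px hp' px'.
wlog le : x p p' hk x0 hp px hp' px' / (size p' <= size p)%N.
  move=> H; have [le|/ltnW le] := leqP (size p') (size p); first exact: (H x p p').
  apply: (H x^-1 p' p) => //; rewrite ?invr_eq0 ?invrK //.
  by rewrite addnC.
pose n' := (size p').-1; pose n := (size p).-1.
have nz r : poly_graph G r 1 -> r != 0.
  move=> hr; apply/eqP => r0; have := hr 0%N; rewrite r0 coef0 coef1 /=.
  by move/(pm_ker hG)/eqP; rewrite oner_eq0.
have p0 := nz _ hp; have p0' := nz _ hp'.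
have sp : size p = n.+1 by rewrite prednK // size_poly_gt0.
have sp' : size p' = n'.+1 by rewrite prednK // size_poly_gt0.
have u1 : G (p'`_0, 1) by have := hp' 0%N; rewrite coef1.
have u0 : p'`_0 != 0 by apply: pm_neq0 u1 (oner_neq0 _).
have n0 : (0 < n)%N.
  rewrite lt0n; apply/eqP => n0.
  move: px; rewrite [p]size1_polyC ?sp ?n0 // hornerC => pp.
  by move/eqP: p0; apply; rewrite [p]size1_polyC ?sp ?n0 // pp.
have lp : G (p`_n, 0) by have := hp n; rewrite coef1 eqn0Ngt n0.
have iu : G ((p'`_0)^-1, 1) by rewrite -[X in (_, X)]invr1; apply: max_inv (oner_neq0 _).
(* The reversal of [p'] vanishes at [x], and its leading coefficient is
   [p'`_0], a unit. *)
pose c := p`_n / p'`_0.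
have Gc : G (c, 0) by have := pmM hG lp iu; rewrite mul0r.
pose rv := \poly_(i < n'.+1) p'`_(n' - i).
have Grv i : exists b, G (rv`_i, b).
  rewrite coef_poly; case: ifP => _; last by exists 0; apply: pm0.
  by eexists; apply: hp'.
have rvx : rv.[x] = 0.
  transitivity (x ^+ n' * p'.[x^-1]); last by rewrite px' mulr0.
  rewrite horner_poly horner_coef sp' mulr_sumr (reindex_inj rev_ord_inj) /=.
  apply: eq_bigr => i _; have le_i : (i <= n')%N by rewrite -ltnS.
  rewrite subSS subKn // mulrCA; congr (_ * _).
  by rewrite exprVn exprB // unitfE.
pose pn := p - c *: ('X^(n - n') * rv).
have lenn : (n' <= n)%N by rewrite -ltnS -sp -sp'.
apply: (IH x pn p') => //; last by rewrite hornerD hornerN hornerZ hornerM px rvx !mulr0 subr0.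
  rewrite -ltnS; apply: leq_trans hk; rewrite ltnS ltn_add2r sp ltnS.
  apply/leq_sizeP => j; rewrite leq_eqVlt => /orP[/eqP<-|hj].
    rewrite coefB coefZ coefXnM ltnNge leq_subr /= subKn // coef_poly ltnS leqnn subnn.
    by rewrite /c divfK ?subrr.
  rewrite coefB coefZ coefXnM nth_default ?sp // ltnNge ltnW ?(leq_ltn_trans (leq_subr _ _) hj) //=.
  rewrite coef_poly ifF ?mulr0 ?subr0 //.
  by apply/negbTE; rewrite -leqNgt ltn_subRL subnK.
have -> : (1 : {poly L}) = 1 - 0 by rewrite subr0.
apply: poly_graphB => // i; rewrite coefZ coef0.
have [b hb] : exists b, G (('X^(n - n') * rv)`_i, b).
  rewrite coefXnM; case: ifP => _; last exact: Grv.
  by exists 0; apply: pm0.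
by have := pmM hG Gc hb; rewrite mul0r.
Qed.

(** If neither [x] nor [x^-1] had a value, both would satisfy relations as in
    [max_relation], against [no_double_relation].  A value of [x^-1] has to be [0],
    because otherwise [max_inv] would give a value of [x]. *)
Lemma max_place x : (exists y, G (x, y)) \/ G (x^-1, 0).
Proof.
have [|hx] := pselect (exists y, G (x, y)); [by left | right].
have {}hx y : ~ G (x, y) by move=> h; apply: hx; exists y.
have x0 : x != 0 by apply/eqP => x0; apply: (hx 0); rewrite x0; apply: pm0.
have [[b hb]|hxV] := pselect (exists y, G (x^-1, y)).
  have [b0|/(max_inv hb)] := eqVneq b 0; first by rewrite -b0.
  by rewrite invrK => /hx.
have {}hxV y : ~ G (x^-1, y) by move=> h; apply: hxV; exists y.
have [p hp px] := max_relation hx; have [p' hp' px'] := max_relation hxV.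
by case: (no_double_relation x0 hp px hp' px').
Qed.

End Maximal.

(** A maximal extension exists by Zorn's lemma, applied to the sets [A] whose
    union with [G] is a partial morphism; this form also covers the empty chain. *)
Theorem place_extension G : partial_morphism G ->
  exists G', [/\ G `<=` G', partial_morphism G' &
    forall x, (exists y, G' (x, y)) \/ G' (x^-1, 0)].
Proof.
move=> hG.
have [F Ftot|A [hA maxA]] := @Zorn_bigcup _ [set A | partial_morphism (A `|` G)].
  move=> Fpm /=.
  have [->|/set0P[B0 FB0]] := eqVneq F set0.
    by rewrite bigcup_set0 /= set0U.
  have pair ab cd : (\bigcup_(X in F) X `|` G) ab -> (\bigcup_(X in F) X `|` G) cd ->
      exists B, [/\ F B, (B `|` G) ab & (B `|` G) cd].
    move=> [[B FB Bab]|Gab] [[C FC Ccd]|Gcd].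
    - have [BC|CB] := Fpm _ _ FB FC.
        by exists C; split => //; left => //; apply: BC.
      by exists B; split => //; left => //; apply: CB.
    - by exists B; split => //; [left|right].
    - by exists C; split => //; [right|left].
    - by exists B0; split => //; right.
  have sub B : F B -> B `|` G `<=` \bigcup_(X in F) X `|` G.
    by move=> FB x [Bx|Gx]; [left; exists B|right].
  split.
  - by right; apply: pm1.
  - move=> a b a' b' h h'; have [B [FB hB hB']] := pair _ _ h h'.
    by apply: (sub _ FB); apply: pmB => //; apply: Ftot.
  - move=> a b a' b' h h'; have [B [FB hB hB']] := pair _ _ h h'.
    by apply: (sub _ FB); apply: pmM => //; apply: Ftot.
  - move=> b h; have [B [FB hB _]] := pair _ _ h h.
    by apply: (pm_ker (Ftot _ FB)).
exists (A `|` G); split => //.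
apply: max_place => // G' hG' sub x G'x.
apply: contrapT => nx; apply: (maxA G').
  split; last by move=> /(_ x G'x) Ax; apply: nx; left.
  by move=> y Ay; apply: sub; left.
rewrite /= (_ : G' `|` G = G') //; apply/seteqP; split => y; last by left.
by case=> // Gy; apply: sub; right.
Qed.

End Places.

(** * Signed areas and collinearity in the plane *)

Section Plane.
Variable F : comPzRingType.
Implicit Types (a b : F * F) (A B C l : F * F * F).

Definition cross a b : F := a.1 * b.2 - a.2 * b.1.
(** Twice the signed area of a triangle, as a sum over its sides.  Sums over the
    triangles then reduce to sums over arcs, and no division is involved. *)
Definition area2 (P : 'I_3 -> F * F) : F := \sum_k cross (P k) (P (ordS k)).

(** Points and lines of the projective plane are both given by homogeneous
    triples; [dot l A] vanishes when [A] lies on [l]. *)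
Definition dot l A : F := l.1.1 * A.1.1 + l.1.2 * A.1.2 + l.2 * A.2.
Definition join A B : F * F * F :=
  (A.1.2 * B.2 - A.2 * B.1.2, A.2 * B.1.1 - A.1.1 * B.2, A.1.1 * B.1.2 - A.1.2 * B.1.1).
Definition det3 A B C : F := dot (join A B) C.
Definition affine_pt a : F * F * F := (1, a.1, a.2).

Lemma crossC a b : cross a b = - cross b a.
Proof. by rewrite /cross; ring. Qed.

Lemma area2E (P : 'I_3 -> F * F) :
  area2 P = cross (P 0) (P 1) + cross (P 1) (P 2%:R) + cross (P 2%:R) (P 0).
Proof.
have l1 : lift ord0 (ord0 : 'I_2) = 1 by apply: val_inj.
have l2 : lift ord0 (lift ord0 (ord0 : 'I_1)) = 2%:R by apply: val_inj.
have s0 : ordS (0 : 'I_3) = 1 by apply: val_inj.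
have s1 : ordS (1 : 'I_3) = 2%:R by apply: val_inj.
have s2 : ordS (2%:R : 'I_3) = 0 by apply: val_inj.
by rewrite /area2 !big_ord_recl big_ord0 addr0 l2 l1 s0 s1 s2 addrA.
Qed.

Lemma area2_det3 (P : 'I_3 -> F * F) :
  area2 P = det3 (affine_pt (P 0)) (affine_pt (P 1)) (affine_pt (P 2%:R)).
Proof. by rewrite area2E /det3 /dot /join /cross /=; ring. Qed.

Lemma dot_joinl A B : dot (join A B) A = 0.
Proof. by rewrite /dot /join /=; ring. Qed.
Lemma dot_joinr A B : dot (join A B) B = 0.
Proof. by rewrite /dot /join /=; ring. Qed.

End Plane.

Section Collinear.
Variable F : fieldType.
Implicit Types (a b : F * F) (A B C l : F * F * F).

Lemma triple_neq0 l : l != 0 -> [\/ l.1.1 != 0, l.1.2 != 0 | l.2 != 0].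
Proof.
case: l => [[x y] z] /= h; have [x0|] := eqVneq x 0; last by constructor 1.
have [y0|] := eqVneq y 0; last by constructor 2.
constructor 3; apply: contra h => /eqP z0; by rewrite x0 y0 z0.
Qed.

(** Each coordinate of [l] times the determinant is a combination of the three
    incidence values. *)
Lemma collinear_det3 l A B C : l != 0 ->
  dot l A = 0 -> dot l B = 0 -> dot l C = 0 -> det3 A B C = 0.
Proof.
move=> /triple_neq0 l0 hA hB hC.
have e1 : l.1.1 * det3 A B C = 0.
  transitivity (dot l A * (join B C).1.1 + dot l B * (join C A).1.1 + dot l C * (join A B).1.1).
    by rewrite /det3 /dot /join /=; ring.
  by rewrite hA hB hC !mul0r !addr0.
have e2 : l.1.2 * det3 A B C = 0.
  transitivity (dot l A * (join B C).1.2 + dot l B * (join C A).1.2 + dot l C * (join A B).1.2).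
    by rewrite /det3 /dot /join /=; ring.
  by rewrite hA hB hC !mul0r !addr0.
have e3 : l.2 * det3 A B C = 0.
  transitivity (dot l A * (join B C).2 + dot l B * (join C A).2 + dot l C * (join A B).2).
    by rewrite /det3 /dot /join /=; ring.
  by rewrite hA hB hC !mul0r !addr0.
by case: l0 => /mulfI; apply; rewrite mulr0.
Qed.

(** By Cramer's rule: each coordinate of [join A B] times [dot l C] is a
    combination of [det3 A B C], [dot l A] and [dot l B]. *)
Lemma det3_collinear l A B C : join A B != 0 ->
  dot l A = 0 -> dot l B = 0 -> det3 A B C = 0 -> dot l C = 0.
Proof.
move=> /triple_neq0 n0 hA hB hd.
have e1 : (join A B).1.1 * dot l C = 0.
  transitivity (l.1.1 * det3 A B C - dot l B * (join C A).1.1 - dot l A * (join B C).1.1).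
    by rewrite /det3 /dot /join /=; ring.
  by rewrite hA hB hd !mul0r mulr0 !subr0.
have e2 : (join A B).1.2 * dot l C = 0.
  transitivity (l.1.2 * det3 A B C - dot l B * (join C A).1.2 - dot l A * (join B C).1.2).
    by rewrite /det3 /dot /join /=; ring.
  by rewrite hA hB hd !mul0r mulr0 !subr0.
have e3 : (join A B).2 * dot l C = 0.
  transitivity (l.2 * det3 A B C - dot l B * (join C A).2 - dot l A * (join B C).2).
    by rewrite /det3 /dot /join /=; ring.
  by rewrite hA hB hd !mul0r mulr0 !subr0.
by case: n0 => /mulfI; apply; rewrite mulr0.
Qed.

Lemma det3_rot A B C : det3 B C A = det3 A B C.
Proof. by rewrite /det3 /dot /join /=; ring. Qed.
Lemma det3_swap A B C : det3 B A C = - det3 A B C.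
Proof. by rewrite /det3 /dot /join /=; ring. Qed.

Lemma join_neq0 A B : A.1.1 = 1 -> B.1.1 = 0 -> B != 0 -> join A B != 0.
Proof.
case: A B => [[a1 a2] a3] [[b1 b2] b3] /= -> ->; apply: contra => /eqP[_ h1 h2].
have b30 : b3 = 0 by apply: oppr_inj; rewrite oppr0 -h1; ring.
have b20 : b2 = 0 by rewrite -h2; ring.
by rewrite b20 b30.
Qed.

End Collinear.

Lemma det_mx22 (F : comPzRingType) (A : 'M[F]_2) :
  \det A = A 0 0 * A 1 1 - A 0 1 * A 1 0.
Proof.
rewrite (expand_det_row _ 0) !big_ord_recl big_ord0 /cofactor !det_mx11 !mxE /=.
have -> : lift ord0 ord0 = 1 :> 'I_2 by apply: val_inj.
have -> : lift 1 0 = 0 :> 'I_2 by apply: val_inj.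
by rewrite /bump /= addn0 expr0 add0n expr1; ring.
Qed.

Lemma area_area2 (R : realType) (P : 'I_3 -> R[i] * R[i]) : area P = 2^-1 * area2 P.
Proof.
rewrite /area area2E; congr (_ * _).
rewrite (expand_det_row _ 0) !big_ord_recl big_ord0 /cofactor !det_mx22 !mxE /=.
have l01 : lift ord0 0 = 1 :> 'I_3 by apply: val_inj.
have l02 : lift ord0 1 = 2%:R :> 'I_3 by apply: val_inj.
have l1 : lift ord0 ord0 = 1 :> 'I_3 by apply: val_inj.
have l2 : lift ord0 (lift ord0 ord0) = 2%:R :> 'I_3 by apply: val_inj.
have l10 : lift 1 0 = 0 :> 'I_3 by apply: val_inj.
have l11 : lift 1 1 = 2%:R :> 'I_3 by apply: val_inj.
have l20 : lift 2%:R 0 = 0 :> 'I_3 by apply: val_inj.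
have l21 : lift 2%:R 1 = 1 :> 'I_3 by apply: val_inj.
rewrite !(l01, l02, l1, l2, l10, l11, l20, l21) /bump /= addn0 !add0n expr0 expr1 sqrrN expr1n.
by rewrite /cross; ring.
Qed.

(** * Total area of a drawing *)

Section AreaSum.
Variables (R : realType) (m n : nat) (T : square_triangulation R m n).
Local Notation D := (Delta T).

Lemma triangle_card i : #|triangle D i| = 3%N.
Proof. by have [_ h] := DeltaP T (triangle D i); have [|] := h; first by exists i. Qed.

Lemma triangle_face i : triangle D i \in faces (T_complex T).
Proof. by have [_ h] := DeltaP T (triangle D i); have [|] := h; first by exists i. Qed.

Lemma Delta_vertex_inj i : injective (D i).
Proof.
have /imset_injP h : #|D i @: 'I_3| == #|'I_3| by rewrite triangle_card card_ord.
by move=> k l; apply: h.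
Qed.

Lemma mem_triangle i k : D i k \in triangle D i.
Proof. by apply: imset_f. Qed.

Lemma edge_face i k l : [set D i k; D i l]%SET \in faces (T_complex T).
Proof.
apply: faces_sub (triangle_face i) _ _.
  by apply/fintype.subsetP => v; rewrite !inE => /orP[] /eqP ->; apply: mem_triangle.
by apply/set0Pn; exists (D i k); rewrite !inE eqxx.
Qed.

Lemma arc_face u v i : Defs.arc D i u v -> [set u; v]%SET \in faces (T_complex T).
Proof. by move=> [k [<- <-]]; apply: edge_face. Qed.

Lemma ord3_cases (k l : 'I_3) : [\/ l = k, l = ordS k | k = ordS l].
Proof.
by case: k l => [[|[|[|?]]] ?] [[|[|[|?]]] ?] //;
  by [constructor 1; apply: val_inj | constructor 2; apply: val_inj
     | constructor 3; apply: val_inj].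
Qed.

Lemma arc_antisym u v i : Defs.arc D i u v -> Defs.arc D i v u -> False.
Proof.
move=> [k [<- <-]] [l [/(@Delta_vertex_inj i) -> /(@Delta_vertex_inj i)]].
by case: k => [[|[|[|?]]] ?] // /(congr1 val).
Qed.

Definition arc_of (ik : 'I_n * 'I_3) : 'I_m * 'I_m := (D ik.1 ik.2, D ik.1 (ordS ik.2)).
Definition arcs : {set 'I_m * 'I_m} := [set arc_of ik | ik : 'I_n * 'I_3]%SET.

Lemma arcsP u v : reflect (exists i, Defs.arc D i u v) ((u, v) \in arcs).
Proof.
apply: (iffP imsetP) => [[[i k] _ [-> ->]]|[i [k [<- <-]]]].
  by exists i, k.
by exists (i, k).
Qed.

(** Coherence of the orientations: no arc occurs in two triangles. *)
Lemma arc_of_inj : injective arc_of.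
Proof.
move=> [i k] [j l] [h1 h2].
have ij : i = j.
  by apply: (@Delta_coherent _ _ _ T (D i k) (D i (ordS k))); [exists k | exists l].
by rewrite /= in h1 h2; subst j; rewrite (Delta_vertex_inj h1).
Qed.

Definition corner_arcs := [:: (cp T, cq T); (cq T, cr T); (cr T, cs T); (cs T, cp T)].

(** Two vertices of a triangle are joined by one of its arcs, in one of the two
    directions.  So an arc is alone on its edge exactly if the reverse arc does not
    occur. *)
Lemma corner_arcsP u v :
  ((u, v) \in corner_arcs) = ((u, v) \in arcs) && ((v, u) \notin arcs).
Proof.
apply/idP/idP.
  move=> /(boundaryP T u v)[i ai hi]; apply/andP; split; first by apply/arcsP; exists i.
  apply/arcsP => -[j aj]; apply: (arc_antisym ai).
  have vj : v \in triangle D j by case: aj => k [<- _]; apply: mem_triangle.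
  have uj : u \in triangle D j by case: aj => k [_ <-]; apply: mem_triangle.
  by rewrite -(hi j).
move=> /andP[/arcsP[i ai] nvu]; apply/(boundaryP T u v); exists i => // j uj vj.
have nuv : u != v.
  by apply/eqP => uv; subst v; apply: (arc_antisym ai ai).
move: uj vj => /imsetP[k _ uk] /imsetP[l _ vl].
case: (ord3_cases k l) => h.
- by move: nuv; rewrite uk vl h eqxx.
- by apply: (@Delta_coherent _ _ _ T u v) => //; exists k; rewrite -h.
- by case/arcsP: nvu; exists j, l; rewrite -h.
Qed.

(** The arcs of interior edges come in opposite pairs, whose contributions
    cancel; the boundary arcs remain. *)
Lemma area2_sum (F : numDomainType) (rho : 'I_m -> F * F) :
  \sum_i area2 (fun k => rho (D i k)) =
  \sum_(uv <- corner_arcs) cross (rho uv.1) (rho uv.2).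
Proof.
rewrite /area2 (pair_big xpredT xpredT) /=.
pose c (uv : 'I_m * 'I_m) := cross (rho uv.1) (rho uv.2).
transitivity (\sum_(uv in arcs) c uv).
  by rewrite big_imset //= => x y _ _; apply: arc_of_inj.
(* The arcs whose reverse occurs contribute nothing. *)
pose sw (uv : 'I_m * 'I_m) := (uv.2, uv.1).
have swK : involutive sw by case.
rewrite (bigID (fun uv => sw uv \in arcs)) /= [X in X + _](_ : _ = 0) ?add0r.
  rewrite big_uniq /=.
    by apply: eq_bigl => -[u v]; rewrite corner_arcsP.
  have := corners_uniq T; rewrite /= !inE !negb_or !xpair_eqE.
  case/and4P => /and3P[pq pr ps] /andP[qr qs] rs _.
  by rewrite ![_ == cp T]eq_sym ?(negbTE pq) ?(negbTE pr) ?(negbTE ps)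
     ?(negbTE qr) ?(negbTE qs) ?(negbTE rs) ?andbF.
set s := \sum_(_ | _) _.
have : s = - s.
  rewrite {1}/s (reindex_inj (inv_inj swK)) /= -sumrN.
  apply: eq_big => [uv|uv _]; first by rewrite swK andbC.
  by rewrite /c crossC.
by move/eqP; rewrite -subr_eq0 opprK -mulr2n mulrn_eq0 => /eqP.
Qed.

End AreaSum.

(** * The generic normalized drawing and its limits *)

Section AffineChange.
Variable F : fieldType.
Implicit Types (P : 'I_3 -> F * F) (p q s : F * F).

(** Affine coordinates in the frame with origin [p] and axes towards [q] and
    [s]. *)
Definition frame_coord p q s (a : F * F) : F * F :=
  (cross (a - p) (s - p) / cross (q - p) (s - p),
   cross (q - p) (a - p) / cross (q - p) (s - p)).

(** An affine change of coordinates multiplies all areas by its determinant. *)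
Lemma area2_frame p q s P : cross (q - p) (s - p) != 0 ->
  area2 (fun k => frame_coord p q s (P k)) = area2 P / cross (q - p) (s - p).
Proof.
move=> d0.
have scale (Q : 'I_3 -> F * F) d :
    area2 (fun k => ((Q k).1 / d, (Q k).2 / d)) = area2 Q / d / d.
  by rewrite !area2E /cross /=; ring.
rewrite /frame_coord.
rewrite (scale (fun k => (cross (P k - p) (s - p), cross (q - p) (P k - p)))).
congr (_ / _); apply: (canLR (mulfK d0)).
by rewrite !area2E /cross /=; ring.
Qed.

Lemma frame_corners p q s : cross (q - p) (s - p) != 0 ->
  [/\ frame_coord p q s p = (0, 0), frame_coord p q s q = (1, 0),
      frame_coord p q s (q + s - p) = (1, 1) & frame_coord p q s s = (0, 1)].
Proof.
move=> d0.
have E (x y : F) : x = 0 -> x / y = 0 by move=> ->; rewrite mul0r.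
have D x : x = cross (q - p) (s - p) -> x / cross (q - p) (s - p) = 1.
  by move=> ->; rewrite divff.
split; rewrite /frame_coord; congr (_, _); (apply: E || apply: D);
  by rewrite /cross /=; ring.
Qed.

End AffineChange.

Section Morphism.
Variables (A B : comPzRingType) (f : {rmorphism A -> B}).
Lemma rmorph_area2 P : f (area2 P) = area2 (fun k => (f (P k).1, f (P k).2)).
Proof. by rewrite !area2E /cross /= !(rmorphD, rmorphN, rmorphM). Qed.
End Morphism.

Module GenericDrawing.
Import mpoly.

Section Homogenize.
Variables (F : fieldType) (n : nat) (l f : {mpoly F[n]}).
Hypothesis l_homog : l \is 1.-homog.

(** Homogenization of [f] by means of a linear form [l] in place of a new
    variable. *)
Definition homogenize : {mpoly F[n]} :=
  \sum_(mm <- msupp f) f@_mm *: ('X_[mm] * l ^+ (msize f - mdeg mm)).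

Lemma homogenize_homog : homogenize \is (msize f).-homog.
Proof.
rewrite /homogenize big_seq; apply: rpred_sum => mm hm.
apply: rpredZ; have le : (mdeg mm <= msize f)%N by apply/ltnW/msize_mdeg_lt.
have hX : 'X_[F, mm] \is (mdeg mm).-homog by rewrite dhomogX.
have hl := dhomogMn (msize f - mdeg mm) l_homog.
by have := dhomogM hX hl; rewrite mul1n subnKC.
Qed.

Lemma meval_homogenize v : l.@[v] != 0 ->
  homogenize.@[v] = l.@[v] ^+ msize f * f.@[fun i => v i / l.@[v]].
Proof.
move=> l0; rewrite /homogenize raddf_sum mevalE mulr_sumr /= big_seq [RHS]big_seq.
apply: eq_bigr => mm hm.
have le : (mdeg mm <= msize f)%N by apply/ltnW/msize_mdeg_lt.
rewrite mevalZ mevalM mevalX rmorphXn /= [RHS]mulrCA; congr (_ * _).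
have -> : l.@[v] ^+ msize f = l.@[v] ^+ mdeg mm * l.@[v] ^+ (msize f - mdeg mm).
  by rewrite -exprD subnKC.
rewrite mulrAC; congr (_ * _).
rewrite mdegE -prodrXr -big_split /=; apply: eq_bigr => i _.
by rewrite expr_div_n mulrC divfK // expf_neq0.
Qed.

End Homogenize.

Section Generic.
Variables (R : realType) (m n : nat) (T : square_triangulation R m n).
Local Notation C := R[i].
Local Notation D := (Delta T).
Local Notation poly := {mpoly C[m + m]}.

(** Constants at the corners build the affine normalization into the drawing:
    the generic areas have a nonzero constant sum, and their polynomial relations
    need not be homogeneous. *)
Definition generic (v : 'I_m) : poly * poly :=
  if v == cp T then (0, 0) else if v == cq T then (1, 0)
  else if v == cr T then (1, 1) else if v == cs T then (0, 1)
  else ('X_(lshift m v), 'X_(rshift m v)).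

Definition generic_area i : poly := area2 (fun k => generic (D i k)).

Lemma corners_neq : [/\ cq T != cp T, cr T != cp T, cr T != cq T &
  [/\ cs T != cp T, cs T != cq T & cs T != cr T]].
Proof.
have := corners_uniq T; rewrite /= !inE !negb_or.
case/and4P => /and3P[pq pr ps] /andP[qr qs] rs _.
by split; last split; rewrite eq_sym.
Qed.

Lemma generic_corners : [/\ generic (cp T) = (0, 0), generic (cq T) = (1, 0),
  generic (cr T) = (1, 1) & generic (cs T) = (0, 1)].
Proof.
have [qp rp rq [sp sq sr]] := corners_neq.
by rewrite /generic !eqxx (negbTE qp) (negbTE rp) (negbTE rq) (negbTE sp) (negbTE sq) (negbTE sr).
Qed.

Lemma generic_eval (rho : 'I_m -> C * C) :
  rho (cp T) = (0, 0) -> rho (cq T) = (1, 0) ->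
  rho (cr T) = (1, 1) -> rho (cs T) = (0, 1) ->
  exists x : 'I_(m + m) -> C, forall v,
    ((generic v).1.@[x], (generic v).2.@[x]) = rho v.
Proof.
move=> hp hq hr hs.
exists (fun j => match fintype.split j with inl v => (rho v).1 | inr v => (rho v).2 end) => v.
rewrite /generic; do 4!(case: eqP => [->|_]; first by rewrite /= ?meval0 ?meval1).
rewrite /= !mevalXU; case: splitP => j /= hj; last first.
  by have := ltn_ord v; rewrite hj ltnNge leq_addr.
case: splitP => k /= hk; first by have := ltn_ord k; rewrite -hk ltnNge leq_addr.
have -> : j = v by apply: val_inj.
have -> : k = v by apply/val_inj/esym/(addnI hk).
by case: (rho v).
Qed.

Definition generic_areas : n.-tuple poly := [tuple generic_area i | i < n].

(** On the vector of the doubled areas [area2], this is the area of the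
    parallelogram.  It equals [1] on normalized drawings, whence the factor
    [2 / \sum_i w 0 i] below. *)
Definition half_sum : {mpoly C[n]} := 2^-1 *: \sum_i 'X_i.

Lemma half_sum_eval v : half_sum.@[v] = 2^-1 * \sum_i v i.
Proof.
by rewrite mevalZ raddf_sum; congr (_ * _); apply: eq_bigr => i _; rewrite /= mevalXU.
Qed.

(** For a drawing with nonzero total area, normalization makes the homogenized
    relation vanish.  One more factor of the total area makes it vanish on the
    degenerate drawings too, hence on the area variety; at [w] this factor can be
    divided out. *)
Lemma generic_relation (w : 'rV[C]_n) (f : {mpoly C[n]}) :
  area_variety T w -> \sum_i w 0 i != 0 -> f \mPo generic_areas = 0 ->
  f.@[fun i => 2 / (\sum_i w 0 i) * w 0 i] = 0.
Proof.
move=> hw s0 hf.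
have two0 : 2 != 0 :> C by rewrite pnatr_eq0.
have lh : half_sum \is 1.-homog.
  by apply: rpredZ; apply: rpred_sum => i _; rewrite dhomogX /= mdeg1.
pose G := homogenize half_sum f * half_sum.
have Gh : G \is (msize f + 1).-homog by apply: dhomogM => //; apply: homogenize_homog.
have : proj_zariski_closed [set u : 'rV[C]_n | u != 0 /\ forall g, [set G]%classic g -> g.@[u 0] = 0]%classic.
  by exists [set G]%classic; split => // g ->; exists (msize f + 1)%N.
move/hw => /(_ _) [|_ /(_ G erefl)].
  move=> u [u0 [rho [dr [c c0 hu]]]]; split => // _ ->.
  rewrite /G mevalM; have [->|l0] := eqVneq half_sum.@[u 0] 0; first by rewrite mulr0.
  rewrite meval_homogenize //.
  pose p := rho (cp T); pose q := rho (cq T); pose s := rho (cs T).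
  have hr : rho (cr T) = q + s - p by rewrite -dr addrC addKr.
  pose d := cross (q - p) (s - p).
  (* Twice the area of the parallelogram is [2 * d]. *)
  have hsum : half_sum.@[u 0] = c * d / 2.
    rewrite half_sum_eval hu.
    under eq_bigr do rewrite !mxE area_area2.
    rewrite -!mulr_sumr area2_sum !big_cons big_nil /= hr -/p -/q -/s /d /cross /=.
    by field.
  have d0 : d != 0 by apply: contraNneq l0 => d0; rewrite hsum d0 mulr0 mul0r.
  have [f1 f2 f3 f4] := frame_corners d0.
  have [x hx] := @generic_eval (fun v => frame_coord p q s (rho v)) f1 f2 (etrans (congr1 _ hr) f3) f4.
  suff -> : f.@[fun i => u 0 i / half_sum.@[u 0]] = 0 by rewrite mulr0 mul0r.
  transitivity (f \mPo generic_areas).@[x]; last by rewrite hf meval0.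
  rewrite comp_mpoly_meval; apply: meval_eq => i.
  rewrite tnth_mktuple /generic_area rmorph_area2 /=.
  transitivity (area2 (fun k => frame_coord p q s (rho (D i k)))).
    rewrite area2_frame // -/d hsum hu !mxE area_area2.
    by field; rewrite d0 c0.
  by rewrite /area2; apply: eq_bigr => k _; rewrite !hx.
have e : half_sum.@[w 0] = 2^-1 * \sum_i w 0 i by rewrite half_sum_eval.
have l0 : half_sum.@[w 0] != 0 by rewrite e mulf_neq0 // invr_neq0.
rewrite /G mevalM meval_homogenize // => /eqP; rewrite !mulf_eq0 expf_eq0 (negbTE l0) andbF orbF /=.
move/eqP => h; rewrite -[RHS]h; apply: meval_eq => i; rewrite e.
by field.
Qed.

(** The values on the generic areas define a partial morphism of the function
    field by [generic_relation]; any place that extends it will do. *)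
Lemma generic_place (w : 'rV[C]_n) :
  area_variety T w -> \sum_i w 0 i != 0 ->
  exists (K : fieldType) (G : set (K * C)) (P : 'I_m -> K * K),
  [/\ partial_morphism G, forall x, (exists y, G (x, y)) \/ G (x^-1, 0),
      [/\ P (cp T) = (0, 0), P (cq T) = (1, 0), P (cr T) = (1, 1) & P (cs T) = (0, 1)] &
      forall i, G (area2 (fun k => P (D i k)), 2 / (\sum_i w 0 i) * w 0 i)].
Proof.
move=> hw s0.
pose K := {fraction poly}.
pose w' := fun i => 2 / (\sum_i w 0 i) * w 0 i.
pose G0 : set (K * C) := [set ab | exists f : {mpoly C[n]},
   ab = (tofrac (f \mPo generic_areas), f.@[w'])]%classic.
have hG0 : partial_morphism G0.
  split.
  - by exists 1; rewrite comp_mpoly1 meval1 tofrac1.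
  - by move=> a b a' b' [f [-> ->]] [g [-> ->]]; exists (f - g); rewrite comp_mpolyB mevalB tofracB.
  - move=> a b a' b' [f [-> ->]] [g [-> ->]]; exists (f * g).
    by rewrite rmorphM mevalM tofracM.
  - move=> b [f [/esym/eqP]]; rewrite tofrac_eq0 => /eqP h ->.
    exact: generic_relation h.
have [G [sG hG tG]] := place_extension hG0.
exists K, G, (fun v => (tofrac (generic v).1, tofrac (generic v).2)); split => //.
  by have [-> -> -> ->] := generic_corners; rewrite /= !tofrac0 !tofrac1.
move=> i; apply: sG; exists 'X_i; rewrite comp_mpolyXU mevalXU; congr (_, _).
rewrite -tnth_nth tnth_mktuple /generic_area.
by rewrite rmorph_area2.
Qed.

End Generic.
End GenericDrawing.
Import GenericDrawing.

Section PlacePoint.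
Variables (K : fieldType) (L : closedFieldType) (G : set (K * L)).
Hypothesis hG : partial_morphism G.
Hypothesis placeG : forall x, (exists y, G (x, y)) \/ G (x^-1, 0).

(** Componentwise specialization of homogeneous coordinates. *)
Definition lifts (H : K * K * K) (A : L * L * L) :=
  [/\ G (H.1.1, A.1.1), G (H.1.2, A.1.2) & G (H.2, A.2)].

Lemma lifts_det3 H1 H2 H3 A1 A2 A3 : lifts H1 A1 -> lifts H2 A2 -> lifts H3 A3 ->
  G (det3 H1 H2 H3, det3 A1 A2 A3).
Proof.
by move=> [? ? ?] [? ? ?] [? ? ?]; rewrite /det3 /dot /join;
  do 2?apply: (pmD hG); apply: (pmM hG) => //; apply: (pmB hG); apply: (pmM hG).
Qed.

(** A place induces a map of projective planes: scale the homogeneous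
    coordinates [(1, x, y)] by a factor [e] that makes all of them finite and one of
    them specialize to [1].  If [x] and [y] are finite, [e = 1]; otherwise [e] is
    the inverse of the dominant coordinate. *)
Lemma projective_limit (a : K * K) : exists eA : K * (L * L * L),
  lifts (eA.1, eA.1 * a.1, eA.1 * a.2) eA.2 /\
  (eA.2.1.1 = 1 /\ eA.1 = 1 \/ eA.2.1.1 = 0 /\ eA.2 != 0).
Proof.
case: a => x y /=.
have big x' y' y2 : G (x'^-1, 0) -> G (y' / x', y2) -> x' != 0 ->
    lifts (x'^-1, x'^-1 * x', x'^-1 * y') (0, 1, y2).
  by move=> h1 h2 x0; split => //=; [rewrite mulVf //; apply: pm1 | rewrite mulrC].
have nz z : (0, 1, z) != 0 :> L * L * L by rewrite !xpair_eqE oner_eq0 andbF.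
have nz' z : (0, z, 1) != 0 :> L * L * L by rewrite !xpair_eqE oner_eq0 andbF.
have inf z : ~ (exists b, G (z, b)) -> G (z^-1, 0) /\ z != 0.
  move=> h; split; first by case: (placeG z).
  by apply/eqP => z0; apply: h; exists 0; rewrite z0; apply: pm0.
have [[bx hx]|/inf[hx x0]] := pselect (exists b, G (x, b)).
  have [[b_y hy]|/inf[hy y0]] := pselect (exists b, G (y, b)).
    exists (1, (1, bx, b_y)); split; last by left.
    by split; rewrite /= ?mul1r //; exact: (pm1 hG).
  exists (y^-1, (0, 0, 1)); split; last by right; split => //; exact: nz'.
  have [h1 h2 h3] : lifts (y^-1, y^-1 * y, y^-1 * x) (0, 1, 0).
    by apply: big => //; have := pmM hG hx hy; rewrite mulr0.
  by split.
have [[b hb]|/inf[hb b0]] := pselect (exists b, G (y / x, b)).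
  by exists (x^-1, (0, 1, b)); split; [apply: big | right; split => //; exact: nz].
rewrite invf_div in hb.
have y0 : y != 0 by apply: contraNneq b0 => ->; rewrite mul0r.
exists (y^-1, (0, 0, 1)); split; last by right; split => //; exact: nz'.
have [h1 h2 h3] : lifts (y^-1, y^-1 * y, y^-1 * x) (0, 1, 0).
  apply: big => //; have := pmM hG hx hb; rewrite mulr0.
  by rewrite mulrA mulVf // mul1r.
by split.
Qed.

End PlacePoint.

(** Scaling the three vertices of a triangle by [e1], [e2], [e3] multiplies the
    area determinant by [e1 * e2 * e3].  Applying the place to this identity gives
    the last clause, which expresses collinearity when one limit is at infinity. *)
Lemma limit_drawing (R : realType) (m n : nat) (T : square_triangulation R m n)
    (w : 'rV[R[i]]_n) :
  area_variety T w -> \sum_i w 0 i != 0 ->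
  exists L : 'I_m -> R[i] * R[i] * R[i],
  [/\ forall v, (L v).1.1 = 1 \/ (L v).1.1 = 0 /\ L v != 0,
      [/\ L (cp T) = (1, 0, 0), L (cq T) = (1, 1, 0), L (cr T) = (1, 1, 1)
        & L (cs T) = (1, 0, 1)] &
      forall i, let L := fun k => L (Delta T i k) in
        det3 (L 0) (L 1) (L 2%:R) =
        (L 0).1.1 * (L 1).1.1 * (L 2%:R).1.1 * (2 / (\sum_i w 0 i) * w 0 i)].
Proof.
move=> hw s0; have [K [G [P [hG tG [Pp Pq Pr Ps] hA]]]] := generic_place hw s0.
have [eA heA] := choice (fun v => projective_limit hG tG (P v)).
have corner v a b a' b' : P v = (a, b) -> G (a, a') -> G (b, b') -> (eA v).2 = (1, a', b').
  move=> Pv ha hb; have [[/= h1 h2 h3] h] := heA v; rewrite Pv /= in h2 h3.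
  move: h h1 h2 h3; case: (eA v) => e [[A0 A1] A2] /= [[-> ->]|[-> nz]] h1.
    by rewrite !mul1r => /(pm_fun hG ha) <- /(pm_fun hG hb) <-.
  move=> /(pm_fun hG (pmM hG h1 ha)); rewrite mul0r => h2.
  move=> /(pm_fun hG (pmM hG h1 hb)); rewrite mul0r => h3.
  by move: nz; rewrite -h2 -h3 eqxx.
exists (fun v => (eA v).2); split.
- by move=> v; have [_ [[-> _]|]] := heA v; [left|right].
- by split; [apply: (corner _ _ _ _ _ Pp)|apply: (corner _ _ _ _ _ Pq)
    |apply: (corner _ _ _ _ _ Pr)|apply: (corner _ _ _ _ _ Ps)]; (apply: pm0 || apply: pm1).
move=> i L.
have h k := (heA (Delta T i k)).1.
apply: (pm_fun hG (lifts_det3 hG (h 0) (h 1) (h 2%:R))).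
set H0 := (_, _, _); set H1 := (X in det3 _ X _); set H2 := (X in det3 _ _ X).
have -> : det3 H0 H1 H2 = (eA (Delta T i 0)).1 * (eA (Delta T i 1)).1 *
    (eA (Delta T i 2%:R)).1 * area2 (fun k => P (Delta T i k)).
  by rewrite area2_det3 /det3 /dot /join /=; ring.
apply: (pmM hG) => //; apply: (pmM hG); last by have [] := h 2%:R.
by apply: (pmM hG); [have [] := h 0 | have [] := h 1].
Qed.

(** * Cocycles on a triangulated disk *)

Module DiskCohomology.
Import topology normedtype.
Import numFieldNormedType.Exports.
Local Open Scope classical_set_scope.

(** The Lebesgue number lemma, for a cover by sets that are only
    neighbourhoods relative to [A]. *)
Lemma lebesgue_number (R : realType) (X : pseudoMetricType R) (A : set X)
    (I : Type) (U : I -> set X) :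
  compact A -> (forall x, A x -> exists i, \forall y \near x, A y -> U i y) ->
  exists2 e : R, 0 < e & forall x, A x -> exists i, forall y, A y -> ball x e y -> U i y.
Proof.
move=> /compact_near_coveringP cA cover.
pose P (e : R) x := exists i, forall y, A y -> ball x e y -> U i y.
have [|e /= e0 he] := cA R (0^'+) P _.
  move=> x /cover[i /nbhs_ballP[r /= r0 hr]].
  have r20 : 0 < r / 2 by rewrite divr_gt0.
  exists (ball x (r / 2), [set e | e < r / 2]) => /=.
    split; first exact: nbhsx_ballx.
    by apply: nbhs_right_lt.
  move=> [x' e] /= [xx' er]; exists i => y Ay xy; apply: (hr y) => //.
  rewrite [r]splitr; apply: ball_triangle xx' _.
  by apply: le_ball xy; apply: ltW.
exists (e / 2) => [|x Ax]; first by rewrite divr_gt0.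
apply: (he (e / 2)) => //=; last by rewrite divr_gt0.
by rewrite /ball /= sub0r normrN gtr0_norm ?divr_gt0 // gtr_pMr // invf_lt1 // ltr1n.
Qed.

Section Cocycle.
Variables (R : realType) (m : nat) (K : simplicial_complex m).
Variable e : 'I_m -> 'I_m -> bool.
Hypothesis eK : forall x y z, [set x; y; z]%SET \in faces K -> e x y (+) e y z = e x z.

Local Notation point := 'rV[R]_m.
Local Notation carrier := (realization (R := R) K).
Implicit Types (x y : point) (u v : 'I_m).

Lemma cocycle_refl u v : [set u; v]%SET \in faces K -> e u u = false.
Proof.
move=> huv; have : [set u; u; u]%SET \in faces K.
  apply: faces_sub huv _ _; first by rewrite !finset.setUid finset.sub1set !inE eqxx.
  by apply/set0Pn; exists u; rewrite !inE eqxx.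
by move/eK; rewrite addbb.
Qed.

Definition supp x : {set 'I_m} := [set v | x 0 v != 0]%SET.

Lemma in_supp_face x u v w : carrier x ->
  u \in supp x -> v \in supp x -> w \in supp x -> e u v (+) e v w = e u w.
Proof.
move=> [_ _ hx] hu hv hw; apply: eK; apply: faces_sub hx _ _.
  by apply/fintype.subsetP => t; rewrite !inE => /orP[/orP[]|] /eqP ->;
    move: hu hv hw; rewrite !inE.
by apply/set0Pn; exists u; rewrite !inE eqxx.
Qed.

Lemma supp_neq0 x : carrier x -> exists v, v \in supp x.
Proof. by move=> [_ _ hx]; apply/set0Pn; apply: faces_neq0 hx. Qed.

Definition vertex_of x : option 'I_m := [pick v in supp x].

Lemma vertex_ofP x : carrier x -> exists2 v, vertex_of x = Some v & v \in supp x.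
Proof.
move=> /supp_neq0[v hv]; rewrite /vertex_of; case: pickP => [u hu|/(_ v)].
  by exists u.
by rewrite hv.
Qed.

(** The trivialization of the cocycle on the open star of [w], measured against
    an arbitrary choice of a vertex in the support of each point. *)
Definition edge_via w x := if vertex_of x is Some v then e w v else false.

(** The difference between the local trivializations of the cocycle at two nearby
    points, computed through a vertex whose open star contains both.  It does not
    depend on that vertex, by [transportE]. *)
Definition transport x y :=
  if [pick w | (w \in supp x) && (w \in supp y)] is Some w
  then edge_via w x (+) edge_via w y else false.

Lemma edge_viaD x v w : carrier x -> v \in supp x -> w \in supp x ->
  edge_via v x (+) edge_via w x = e v w.
Proof.
move=> hx hv hw; rewrite /edge_via; have [u -> hu] := vertex_ofP hx.
rewrite -(in_supp_face hx hv hw hu).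
by case: (e v w); case: (e w u).
Qed.

Lemma transportE w x y : carrier x -> carrier y -> w \in supp x -> w \in supp y ->
  transport x y = edge_via w x (+) edge_via w y.
Proof.
move=> hx hy wx wy; rewrite /transport; case: pickP => [v /andP[vx vy]|/(_ w)]; last first.
  by rewrite wx wy.
have := edge_viaD hx vx wx; rewrite -(edge_viaD hy vy wy).
by case: (edge_via v x); case: (edge_via w x); case: (edge_via v y); case: (edge_via w y).
Qed.

Section Disk.
Variables (E : normedModType R) (B : set E) (g : E -> point).
Hypothesis cB : compact B.
Hypothesis starB : forall z (t : R), B z -> 0 <= t <= 1 -> B (t *: z).
Hypothesis gB : forall z, B z -> carrier (g z).
Hypothesis g_cont : {within B, continuous g}.

(** The open stars of the vertices cover the complex, so their preimages cover
    [B] with a positive Lebesgue number. *)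
Lemma star_cover : exists2 d : R, 0 < d & forall z, B z ->
  exists v, forall z', B z' -> `|z - z'| < d -> v \in supp (g z').
Proof.
have [|d d0 hd] := @lebesgue_number R E B 'I_m (fun v => [set z | v \in supp (g z)]) cB.
  move=> z Bz; have [v hv] := supp_neq0 (gB Bz); exists v.
  have : \forall x \near g z, (x : point) 0 v != 0.
    move: hv; rewrite inE => hv.
    have /(_ _)/cvgr_neq0 : continuous (fun x : point => x 0 v) by exact: coord_continuous.
    exact.
  move/subspace_continuousP/(_ _ Bz) : g_cont => /[apply].
  rewrite /= /nbhs /= /within /=.
  by apply: filterS => y + By => /(_ By); rewrite inE.
exists d => // z Bz; have [v hv] := hd z Bz; exists v => z' Bz' zz'.
by apply: hv => //; rewrite -ball_normE.
Qed.

(** Contractibility of [B] makes the cocycle a coboundary: [H z] accumulates the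
    transport along the segment from [0] to [z], cut into [N] steps.  For close [z]
    and [z'], the two segments form a ladder whose rungs and steps are all short,
    so that the cocycle condition applies to each of its squares. *)
Lemma disk_primitive : exists (H : E -> bool) (d : R), 0 < d /\
  forall z z', B z -> B z' -> `|z - z'| < d ->
    exists w, [/\ w \in supp (g z), w \in supp (g z') &
      H z (+) H z' = edge_via w (g z) (+) edge_via w (g z')].
Proof.
have [d d0 hd] := star_cover.
have [M hM] : exists M : R, forall z, B z -> `|z| <= M.
  have /compact_bounded[M [_ hM]] := cB.
  by exists (M + 1) => z Bz; apply: hM Bz; rewrite ltrDl.
have [N0 hN0] : exists N : nat, M / (d / 2) < N%:R.
  exists (Num.truncn (M / (d / 2))).+1; exact: truncnS_gt.
pose N := N0.+1.
have N_gt0 : (0 : R) < N%:R by rewrite ltr0n.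
have hN z : B z -> `|z| / N%:R < d / 2.
  move=> Bz; rewrite ltr_pdivrMr // mulrC -ltr_pdivrMr ?divr_gt0 //.
  apply: le_lt_trans (lt_trans hN0 _); last by rewrite ltr_nat.
  by rewrite ler_pM2r ?invr_gt0 ?divr_gt0 //; apply: hM.
pose pt j (z : E) := (j%:R / N%:R) *: z.
have Bpt j z : (j <= N)%N -> B z -> B (pt j z).
  move=> hj Bz; apply: starB => //; rewrite divr_ge0 //= ler_pdivrMr // mul1r.
  by rewrite ler_nat.
pose H j z := \big[addb/false]_(k < j) transport (g (pt k z)) (g (pt k.+1 z)).
exists (H N), (d / 2); split; first by rewrite divr_gt0.
move=> z z' Bz Bz' zz'.
have step j : (j < N)%N -> forall z, B z -> `|pt j z - pt j.+1 z| < d / 2.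
  move=> hj t Bt; rewrite -scalerBl -mulrBl normrZ normrM distrC -natrB // subSnn.
  by rewrite normr1 mul1r gtr0_norm ?invr_gt0 // mulrC; apply: hN.
have ladder j : (j <= N)%N -> `|pt j z - pt j z'| < d / 2.
  move=> hj; rewrite -scalerBr normrZ; apply: le_lt_trans zz'.
  rewrite ger0_norm ?divr_ge0 //; apply: ler_piMl => //.
  by rewrite ler_pdivrMr // mul1r ler_nat.
have main j : (j <= N)%N -> H j z (+) H j z' = transport (g (pt j z)) (g (pt j z')).
  elim: j => [_|j IH hj].
    rewrite /H !big_ord0 /= /pt !mul0r !scale0r.
    have C0 : carrier (g 0).
      apply: gB; rewrite -[0](scale0r z); apply: starB => //.
      by rewrite lexx ler01.
    by have [w hw] := supp_neq0 C0; rewrite (transportE C0 C0 hw hw) addbb.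
  have hj' : (j <= N)%N by apply: ltnW.
  rewrite /H !big_ord_recr /= -/(H j z) -/(H j z').
  have Ba := Bpt j z hj' Bz; have Bb := Bpt j z' hj' Bz'.
  have Bc := Bpt j.+1 z hj Bz; have Bd := Bpt j.+1 z' hj Bz'.
  (* One star contains all four corners of the square between two rungs. *)
  have [w hw] := hd _ Ba.
  have wa : w \in supp (g (pt j z)) by apply: hw => //; rewrite subrr normr0.
  have d2 : d / 2 < d by rewrite gtr_pMr // invf_lt1 // ltr1n.
  have wb : w \in supp (g (pt j z')) by apply: hw => //; apply: lt_trans (ladder _ hj') d2.
  have wc : w \in supp (g (pt j.+1 z)) by apply: hw => //; apply: lt_trans (step _ hj _ Bz) d2.
  have wd : w \in supp (g (pt j.+1 z')).
    apply: hw => //; rewrite [d]splitr; apply: le_lt_trans (ltrD (ladder _ hj') (step _ hj _ Bz')).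
    exact: ler_distD.
  have := IH hj'; move: (gB Ba) (gB Bb) (gB Bc) (gB Bd) => Ca Cb Cc Cd.
  rewrite (transportE Ca Cb wa wb) (transportE Ca Cc wa wc) (transportE Cb Cd wb wd).
  rewrite (transportE Cc Cd wc wd).
  move: (edge_via _ _) (edge_via _ _) (edge_via _ _) (edge_via _ _) (H j z) (H j z').
  by do 6!case.
have := main N (leqnn N); rewrite /pt divff ?pnatr_eq0 // !scale1r => ->.
have [w hw] := hd _ Bz; exists w.
have wz : w \in supp (g z) by apply: hw => //; rewrite subrr normr0.
have wz' : w \in supp (g z').
  by apply: hw => //; apply: lt_trans zz' _; rewrite gtr_pMr // invf_lt1 // ltr1n.
by split => //; apply: transportE => //; apply: gB.
Qed.

Variable f : point -> E.
Hypothesis fB : forall x, carrier x -> B (f x).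
Hypothesis gfK : forall x, carrier x -> g (f x) = x.
Hypothesis f_cont : {within carrier, continuous f}.

Definition segment (u v : 'I_m) (t : R) : point :=
  (1 - t) *: delta_mx 0 u + t *: delta_mx 0 v.

Lemma segmentE u v t w : segment u v t 0 w = (1 - t) * (w == u)%:R + t * (w == v)%:R.
Proof. by rewrite !mxE eqxx. Qed.

Lemma supp_segment u v t : supp (segment u v t) \subset [set u; v]%SET.
Proof.
apply/fintype.subsetP => w; rewrite !inE segmentE; apply: contraR.
by rewrite negb_or => /andP[/negbTE-> /negbTE->]; rewrite !mulr0 addr0.
Qed.

Lemma carrier_segment u v t : [set u; v]%SET \in faces K -> 0 <= t <= 1 ->
  carrier (segment u v t).
Proof.
move=> huv /andP[t0 t1].
have s1 : \sum_w segment u v t 0 w = 1.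
  under eq_bigr do rewrite segmentE.
  rewrite big_split /= -!mulr_sumr.
  have one w : \sum_(i < m) ((i == w)%:R : R) = 1.
    by rewrite (bigD1 w) //= eqxx big1 ?addr0 // => i /negbTE->.
  by rewrite !one !mulr1 subrK.
split => //.
- by move=> w; rewrite segmentE addr_ge0 // mulr_ge0 ?subr_ge0.
- apply: faces_sub huv (supp_segment u v t) _.
  apply/set0Pn; apply: contrapT => h.
  move/eqP: s1; rewrite big1 ?(eq_sym 0) ?oner_eq0 // => w _.
  by apply/eqP/negPn/negP => hw; apply: h; exists w; rewrite inE.
Qed.

Lemma segment_cocycle u v a b c : [set u; v]%SET \in faces K ->
  a \in [set u; v]%SET -> b \in [set u; v]%SET -> c \in [set u; v]%SET ->
  e a b (+) e b c = e a c.
Proof.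
move=> huv ha hb hc; apply: eK; apply: faces_sub huv _ _.
  by apply/fintype.subsetP => t; rewrite 2!finset.in_setU !finset.in_set1 => /orP[/orP[]|] /eqP ->.
by apply/set0Pn; exists a; rewrite !inE eqxx.
Qed.

Lemma segment_continuous u v : continuous (segment u v : R -> point).
Proof.
move=> t; apply: cvgD; apply: cvgZr_tmp; last exact: cvg_id.
by apply: cvgB; [exact: cvg_cst | exact: cvg_id].
Qed.

(** The values of [H] at the vertices.  Along an edge from [u] to [v], the sum of
    [H] and of the local trivialization based at [u] does not change over short
    steps, hence takes the same value at both ends. *)
Lemma coboundary : exists h : 'I_m -> bool,
  forall u v, [set u; v]%SET \in faces K -> e u v = h u (+) h v.
Proof.
have [H [d [d0 hH]]] := disk_primitive.
exists (fun v => H (f (delta_mx 0 v))) => u v huv.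
pose A : set R := `[(0 : R), 1].
have AP t : A t <-> 0 <= t <= 1 by rewrite /A /= in_itv.
have cA : compact A by exact: segment_compact.
pose x := segment u v.
have Cx t : 0 <= t <= 1 -> carrier (x t) by apply: carrier_segment.
have d2 : 0 < d / 2 by rewrite divr_gt0.
have [|r r0 hr] := @lebesgue_number R R A R
    (fun t0 => [set t | `|f (x t0) - f (x t)| < d / 2]) cA.
  move=> t /AP At; exists t.
  move/subspace_continuousP/(_ _ (Cx _ At))/cvgrPdist_lt/(_ _ d2) : f_cont => hf.
  have : \forall t' \near t, carrier (x t') -> `|f (x t) - f (x t')| < d / 2.
    exact: (@segment_continuous u v t _ hf).
  by apply: filterS => t' /= + /AP At'; apply; apply: Cx.
have [N0 hN0] : exists N : nat, r^-1 < N%:R.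
  by exists (Num.truncn r^-1).+1; exact: truncnS_gt.
pose N := N0.+1.
have N_gt0 : (0 : R) < N%:R by rewrite ltr0n.
have hN : N%:R^-1 < r.
  rewrite -[r]invrK ltf_pV2 ?posrE ?invr_gt0 //; apply: lt_trans hN0 _.
  by rewrite ltr_nat.
pose t j : R := j%:R / N%:R.
have At j : (j <= N)%N -> 0 <= t j <= 1.
  by move=> hj; rewrite divr_ge0 //= ler_pdivrMr // mul1r ler_nat.
pose chi j := H (f (x (t j))) (+) edge_via u (x (t j)).
have via w j : (j <= N)%N -> w \in [set u; v]%SET ->
    edge_via w (x (t j)) = e w u (+) edge_via u (x (t j)).
  move=> hj hw; rewrite /edge_via; have [a -> ha] := vertex_ofP (Cx _ (At _ hj)).
  have hu : u \in [set u; v]%SET by rewrite !inE eqxx.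
  have {}ha : a \in [set u; v]%SET by have /fintype.subsetP := supp_segment u v (t j); apply.
  exact/esym/(segment_cocycle huv hw hu ha).
have chiS j : (j < N)%N -> chi j = chi j.+1.
  move=> hj; have hj' := ltnW hj.
  have close : `|f (x (t j)) - f (x (t j.+1))| < d.
    have [|s hs] := hr (t j); first by apply/AP/At.
    rewrite [d]splitr; apply: le_lt_trans (ler_distD (f (x s)) _ _) _.
    apply: ltrD; first (rewrite distrC; apply: (hs (t j))).
    - by apply/AP/At.
    - exact: ballxx.
    - apply: (hs (t j.+1)); first by apply/AP/At.
      rewrite -ball_normE /= distrC -mulrBl -natrB // subSnn mul1r.
      by rewrite gtr0_norm ?invr_gt0.
  have [w [w1 w2]] := hH _ _ (fB (Cx _ (At _ hj'))) (fB (Cx _ (At _ hj))) close.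
  rewrite !gfK in w1 w2 *; try by apply: Cx; apply: At.
  have wuv : w \in [set u; v]%SET by have /fintype.subsetP := supp_segment u v (t j); apply.
  rewrite (via w j hj' wuv) (via w j.+1 hj wuv) /chi.
  by move: (H _) (H _) (edge_via _ _) (edge_via _ _) (e w u); do 5!case.
have chi0 j : (j <= N)%N -> chi j = chi 0%N.
  by elim: j => // j IH hj; rewrite -chiS // IH // ltnW.
have x0 : x (t 0%N) = delta_mx 0 u.
  by rewrite /x /segment /t mul0r subr0 scale1r scale0r addr0.
have x1 : x (t N) = delta_mx 0 v.
  by rewrite /x /segment /t divff ?pnatr_eq0 // subrr scale0r scale1r add0r.
have via_delta w : edge_via u (delta_mx 0 w) = e u w.
  rewrite /edge_via /vertex_of; case: pickP => [a|/(_ w)]; rewrite !inE mxE !eqxx /=.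
    by have [->//|_] := eqVneq a w; rewrite eqxx.
  by rewrite oner_eq0.
have := chi0 N (leqnn N); rewrite /chi x0 x1 !via_delta (cocycle_refl huv).
by case: (H _); case: (H _); case: (e u v).
Qed.

End Disk.

End Cocycle.

Lemma closed_disk_compact (R : realType) : compact (closed_disk (R := R)).
Proof.
pose Q : set (R * R) := `[(-1 : R), 1] `*` `[(-1 : R), 1].
apply: (@subclosed_compact _ _ Q).
- pose F (z : R * R) := z.1 * z.1 + z.2 * z.2.
  have cF : continuous F.
    by move=> z; apply: cvgD; apply: cvgM; (exact: cvg_fst || exact: cvg_snd).
  rewrite (_ : @closed_disk R = F @^-1` [set t | t <= 1]).
    by apply: preimage_closed => //; exact: closed_le.
  by apply/funext => z; rewrite /closed_disk /F /= !expr2.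
- by apply: compact_setX; exact: segment_compact.
- move=> [a b]; rewrite /closed_disk /Q /= !in_itv /= => h.
  by split; apply/andP; split; nra.
Qed.

Lemma closed_disk_star (R : realType) (z : R * R) (t : R) :
  closed_disk z -> 0 <= t <= 1 -> closed_disk (t *: z).
Proof.
case: z => a b; rewrite /closed_disk /= => h /andP[t0 t1].
rewrite /GRing.scale /= !exprMn -mulrDr.
apply: le_trans h; apply: ler_piMl; first by rewrite addr_ge0 ?sqr_ge0.
by rewrite expr_le1.
Qed.

(** The first cohomology modulo 2 of a triangulated disk vanishes.  A disk is
    compact and star-shaped, so [coboundary] applies to any homeomorphism onto
    it. *)
Lemma disk_cohomology (R : realType) (m : nat) (K : simplicial_complex m)
    (e : 'I_m -> 'I_m -> bool) :
  homeomorphic (realization (R := R) K) (@closed_disk R) ->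
  (forall x y z, [set x; y; z]%SET \in faces K -> e x y (+) e y z = e x z) ->
  exists h : 'I_m -> bool,
    forall u v, [set u; v]%SET \in faces K -> e u v = h u (+) h v.
Proof.
move=> [f [g [[fc gc] fB gB gfK _]]] eK.
exact: (coboundary eK (@closed_disk_compact R) (@closed_disk_star R) gB gc fB gfK fc).
Qed.

End DiskCohomology.

(** * Redrawing the vertices with infinite limit *)

Section Redraw.
Variables (R : realType) (m n : nat) (T : square_triangulation R m n).
Local Notation D := (Delta T).
Local Notation K := (faces (T_complex T)).
Variables (F : fieldType) (w : 'I_n -> F) (L : 'I_m -> F * F * F).
Hypothesis L_fin : forall v, (L v).1.1 = 1 \/ (L v).1.1 = 0 /\ L v != 0.
Hypothesis L_det : forall i, det3 (L (D i 0)) (L (D i 1)) (L (D i 2%:R)) =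
  (L (D i 0)).1.1 * (L (D i 1)).1.1 * (L (D i 2%:R)).1.1 * w i.
Hypothesis L_corner : forall v, v \in [:: cp T; cq T; cr T; cs T] -> (L v).1.1 = 1.

Definition finite_vertex v := (L v).1.1 == 1.

Lemma infiniteP v : finite_vertex v = false -> (L v).1.1 = 0 /\ L v != 0.
Proof. by rewrite /finite_vertex; case: (L_fin v) => // ->; rewrite eqxx. Qed.

Definition core_adj u v := [&& finite_vertex u, finite_vertex v & [set u; v]%SET \in K].

(** Connectedness of the core is what makes a primitive of a cocycle supported
    away from it constant on the corners and on all their finite neighbours; the
    set of all vertices with finite limit may be disconnected. *)
Definition core : {set 'I_m} := [set v | connect core_adj (cp T) v]%SET.
Definition piece_adj u v := [&& u \notin core, v \notin core & [set u; v]%SET \in K].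
Definition interface a u := [&& a \in core, u \notin core & [set a; u]%SET \in K].

Lemma core_adj_sym : connect_sym core_adj.
Proof. by apply: sym_connect_sym => u v; rewrite /core_adj finset.setUC andbCA. Qed.
Lemma piece_adj_sym : connect_sym piece_adj.
Proof. by apply: sym_connect_sym => u v; rewrite /piece_adj finset.setUC andbCA. Qed.

Lemma core_finite v : v \in core -> finite_vertex v.
Proof.
rewrite inE => h; suff: finite_vertex v = finite_vertex (cp T) by move=> ->; rewrite /finite_vertex L_corner ?inE ?eqxx.
symmetry; apply: (closed_connect (a := finite_vertex) _ h).
by move=> x y /and3P[fx fy _]; rewrite -!topredE /= fx fy.
Qed.

Lemma core_corner v : v \in [:: cp T; cq T; cr T; cs T] -> v \in core.
Proof.
have step u v' : (u, v') \in corner_arcs T -> u \in core -> v' \in core.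
  move=> uv uO; move: (uO); rewrite !inE => h; apply: connect_trans h (connect1 _).
  rewrite /core_adj (core_finite uO) /=.
  move/(boundaryP T u v') : (uv) => [i /arc_face -> _]; rewrite andbT.
  apply/eqP/L_corner; move: uv; rewrite !inE !xpair_eqE.
  by case/or4P => /andP[_ ->]; rewrite ?orbT.
have hp : cp T \in core by rewrite inE connect0.
have hq : cq T \in core by apply: step hp; rewrite !inE eqxx.
have hr : cr T \in core by apply: step hq; rewrite !inE eqxx ?orbT.
have hs : cs T \in core by apply: step hr; rewrite !inE eqxx ?orbT.
move=> hv; have : [|| v == cp T, v == cq T, v == cr T | v == cs T].
  by move: hv; rewrite !inE.
by case/or4P => /eqP ->.
Qed.

Lemma core_step x y : finite_vertex y -> [set x; y]%SET \in K -> x \in core -> y \in core.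
Proof.
move=> fy xy xO; move: (xO); rewrite !inE => h; apply: connect_trans h (connect1 _).
by rewrite /core_adj (core_finite xO) fy.
Qed.

(** Otherwise [u] would belong to the core. *)
Lemma interface_infinite a u : interface a u -> (L u).1.1 = 0 /\ L u != 0.
Proof.
move=> /and3P[aO uO au]; apply: infiniteP; apply/negP => fu.
by move/negP: uO; apply; apply: core_step au aO.
Qed.

Lemma interface_join_neq0 a u : interface a u -> join (L a) (L u) != 0.
Proof.
move=> au; have [u0 u1] := interface_infinite au; apply: join_neq0 => //.
by case/and3P: au => /core_finite/eqP.
Qed.

Lemma face_pair x y (s : {set 'I_m}) : x \in s -> y \in s -> s \in K -> [set x; y]%SET \in K.
Proof.
move=> hx hy hs; apply: faces_sub hs _ _.
  by apply/fintype.subsetP => v; rewrite !inE => /orP[] /eqP ->.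
by apply/set0Pn; exists x; rewrite !inE eqxx.
Qed.

(** One factor of the right-hand side of the determinant equation vanishes; the
    vertices may come in any order. *)
Lemma face_det x y z : [set x; y; z]%SET \in K -> uniq [:: x; y; z] ->
  (L x).1.1 = 0 -> det3 (L x) (L y) (L z) = 0.
Proof.
move=> hK hu x0.
have c3 : #|[set x; y; z]%SET| = 3%N.
  rewrite (_ : 3%N = size [:: x; y; z]) // -(card_uniqP hu); apply: eq_card => v.
  by rewrite !inE orbA.
have [i hi] : exists i, [set x; y; z]%SET = triangle D i by apply/(DeltaP T).
have mem v : v \in [:: x; y; z] -> exists k, v = D i k.
  move=> hv; have /imsetP[k _ ->] : v \in triangle D i by rewrite -hi !inE -orbA; move: hv; rewrite !inE.
  by exists k.
have [a xa] : exists k, x = D i k by apply: mem; rewrite !inE eqxx.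
have [b yb] : exists k, y = D i k by apply: mem; rewrite !inE eqxx ?orbT.
have [c zc] : exists k, z = D i k by apply: mem; rewrite !inE eqxx ?orbT.
have d0 : det3 (L (D i 0)) (L (D i 1)) (L (D i 2%:R)) = 0.
  rewrite L_det; rewrite xa in x0; move: x0.
  have : a \in [:: 0; 1; 2%:R].
    by case: (a) => [[|[|[|?]]] ?].
  by rewrite !inE => /or3P[] /eqP -> ->; rewrite ?(mul0r, mulr0).
have := hu; rewrite /= !inE negb_or xa yb zc !(inj_eq (@Delta_vertex_inj _ _ _ T i)).
have all3 (k : 'I_3) : [\/ k = 0, k = 1 | k = 2%:R].
  by case: k => [[|[|[|?]]] ?] //; [constructor 1|constructor 2|constructor 3]; apply: val_inj.
have N A B C : det3 B A C = 0 -> det3 A B C = 0 :> F by rewrite [det3 A B C]det3_swap => ->; rewrite oppr0.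
by case: (all3 a) => ->; case: (all3 b) => ->; case: (all3 c) => -> // _;
  do ?[exact: d0 | by rewrite det3_rot | by rewrite -det3_rot
      | by apply: N | by apply: N; rewrite det3_rot | by apply: N; rewrite -det3_rot].
Qed.

(** The limits of [a] and [u] are distinct, so their line is the only one
    that contains them, and it contains the limit of [z]. *)
Lemma interface_line_third l a u z : interface a u -> [set a; u; z]%SET \in K ->
  dot l (L a) = 0 -> dot l (L u) = 0 -> dot l (L z) = 0.
Proof.
move=> au hK la lu.
have [->//|za] := eqVneq z a; have [->//|zu] := eqVneq z u.
apply: (det3_collinear (interface_join_neq0 au)) => //.
have ua : u != a by case/and3P: au => aO uO _; apply: contraNneq uO => ->.
have [u0 _] := interface_infinite au.
rewrite -det3_rot; apply: face_det => //.
  by rewrite (_ : [set u; z; a] = [set a; u; z])%SET // finset.setUC finset.setUA.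
by rewrite /= !inE negb_or ua (eq_sym u z) zu za.
Qed.

Section Component.
Variables a0 u0 : 'I_m.
Hypothesis interface0 : interface a0 u0.
Let l := join (L a0) (L u0).
Let piece : {set 'I_m} := [set v | connect piece_adj u0 v]%SET.
Let p v := dot l (L v) == 0.

Lemma piece_notin_core v : v \in piece -> v \notin core.
Proof.
rewrite inE => h; have u0O : u0 \notin core by case/and3P: interface0.
have cl : closed piece_adj [pred v | v \notin core].
  by move=> x y /and3P[xO yO _]; rewrite !inE in xO yO *; rewrite xO yO.
by have := closed_connect cl h; rewrite !inE in u0O *; rewrite u0O => <-.
Qed.

Lemma piece_step x y : x \in piece -> [set x; y]%SET \in K -> y \notin core -> y \in piece.
Proof.
move=> xU xy yO; have xO := piece_notin_core xU; move: xU; rewrite !inE => h.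
by apply: connect_trans h (connect1 _); rewrite /piece_adj xO yO.
Qed.

(** The indicator of the edges between the core and the piece of [u0] with both
    limits on the line [l] of the edge from [a0] to [u0]: the dual closed curve
    through that edge, together with those that share its line. *)
Definition crossing x y :=
  ((x \in core) && (y \in piece) || (y \in core) && (x \in piece)) && p x && p y.

(** A triangle meeting both the core and the piece has all its vertices in
    their union and, by [interface_line_third], has all its limits on [l] as soon
    as one of its edges between the two sides is on [l].  So either none or
    exactly two of its edges are crossing. *)
Lemma crossing_cocycle x y z : [set x; y; z]%SET \in K ->
  crossing x y (+) crossing y z = crossing x z.
Proof.
move=> hK.
have pr s t : s \in [set x; y; z]%SET -> t \in [set x; y; z]%SET -> [set s; t]%SET \in K.
  by move=> hs ht; apply: face_pair hs ht hK.
have F1 s t : s \in [set x; y; z]%SET -> t \in [set x; y; z]%SET ->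
    (s \in piece) && (t \notin core) ==> (t \in piece).
  by move=> hs ht; apply/implyP => /andP[sU]; apply: piece_step (pr _ _ hs ht).
have F2 s t r : [set s; t; r]%SET = [set x; y; z]%SET ->
    [&& s \in core, t \in piece, p s & p t] ==> p r.
  move=> E; apply/implyP => /and4P[sO tU ps pt]; apply/eqP.
  apply: (@interface_line_third l s t); rewrite ?E //; [|exact/eqP|exact/eqP].
  rewrite /interface sO piece_notin_core //=; apply: pr; rewrite -E !inE eqxx ?orbT //.
have hx : x \in [set x; y; z]%SET by rewrite !inE eqxx.
have hy : y \in [set x; y; z]%SET by rewrite !inE eqxx ?orbT.
have hz : z \in [set x; y; z]%SET by rewrite !inE eqxx ?orbT.
have perm s t r : [set s; t; r]%SET = [set x; y; z]%SET -> [set t; s; r]%SET = [set x; y; z]%SET.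
  by move=> <-; rewrite [in RHS](finset.setUC [set s]%SET).
have rot s t r : [set s; t; r]%SET = [set x; y; z]%SET -> [set t; r; s]%SET = [set x; y; z]%SET.
  by move=> <-; rewrite [in LHS]finset.setUC finset.setUA.
have e1 : [set x; y; z]%SET = [set x; y; z]%SET by [].
have e2 := rot _ _ _ e1; have e3 := rot _ _ _ e2.
have f1 := F2 _ _ _ e1; have f2 := F2 _ _ _ e2; have f3 := F2 _ _ _ e3.
have g1 := F2 _ _ _ (perm _ _ _ e1); have g2 := F2 _ _ _ (perm _ _ _ e2).
have g3 := F2 _ _ _ (perm _ _ _ e3).
have uxy := F1 _ _ hx hy; have uxz := F1 _ _ hx hz; have uyx := F1 _ _ hy hx.
have uyz := F1 _ _ hy hz; have uzx := F1 _ _ hz hx; have uzy := F1 _ _ hz hy.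
have /implyP nx := @piece_notin_core x; have /implyP ny := @piece_notin_core y; have /implyP nz := @piece_notin_core z.
rewrite /crossing.
clear e1 e2 e3 perm rot hx hy hz F1 F2 pr hK.
move: (x \in core) (x \in piece) (p x) (y \in core) (y \in piece) (p y) (z \in core) (z \in piece) (p z)
  nx ny nz uxy uxz uyx uyz uzx uzy f1 f2 f3 g1 g2 g3.
by do 9![case].
Qed.

(** A primitive [h] of [crossing] is constant on the core and on the piece,
    both being connected without crossing edges.  So all edges between them
    behave like the edge from [a0] to [u0]. *)
Lemma component_line a u : interface a u -> connect piece_adj u0 u -> dot l (L a) = 0.
Proof.
move=> au u0u.
have [h hh] := DiskCohomology.disk_cohomology (T_disk T) crossing_cocycle.
have cross0 x y : [set x; y]%SET \in K -> x \notin piece -> y \notin piece -> h x = h y.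
  move=> xy xU yU; have := hh x y xy.
  by rewrite /crossing (negbTE xU) (negbTE yU) !andbF /=; case: (h x); case: (h y).
have cross1 x y : [set x; y]%SET \in K -> x \notin core -> y \notin core -> h x = h y.
  move=> xy xO yO; have := hh x y xy.
  by rewrite /crossing (negbTE xO) (negbTE yO) /=; case: (h x); case: (h y).
have hO x : x \in core -> h x = h (cp T).
  rewrite inE => hx; apply/eqP.
  pose A := [pred v | (v \in core) && (h v == h (cp T))].
  suff: x \in A by case/andP.
  rewrite -(closed_connect (a := mem A) _ hx) ?inE ?connect0 ?eqxx //.
  apply: (intro_closed core_adj_sym) => y z yz; rewrite !inE => /andP[hy /eqP <-].
  have hz : connect core_adj (cp T) z by apply: connect_trans hy (connect1 yz).
  rewrite hz /= eq_sym; apply/eqP/cross0; first by case/and3P: yz.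
    by apply/negP => /piece_notin_core; rewrite inE hy.
  by apply/negP => /piece_notin_core; rewrite inE hz.
have hU x : connect piece_adj u0 x -> h x = h u0.
  move=> hx; apply/eqP.
  pose A := [pred v | h v == h u0].
  change (x \in A).
  rewrite -(closed_connect (a := mem A) _ hx) ?inE ?eqxx //.
  by apply: (intro_closed piece_adj_sym) => y z /and3P[hy hz yz]; rewrite !inE => /eqP <-; rewrite (cross1 y z).
have aO : a \in core by case/and3P: au.
have a0O : a0 \in core by case/and3P: interface0.
have : crossing a u = crossing a0 u0.
  rewrite (hh a u) ?(hh a0 u0); try by [case/and3P: au|case/and3P: interface0].
  by rewrite (hO a aO) (hO a0 a0O) (hU u u0u).
have -> : crossing a0 u0 by rewrite /crossing a0O inE connect0 /p dot_joinl dot_joinr eqxx.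
by case/andP => /andP[_ /eqP].
Qed.

End Component.

Definition limit_pos v : F * F := ((L v).1.2, (L v).2).
(** A core vertex adjacent to the piece of [v].  As [pick] only depends on the
    extension of the predicate, the vertices of one piece share their anchor. *)
Definition anchor v := [pick a | [exists u, interface a u && connect piece_adj v u]].
Definition redraw v :=
  if v \in core then limit_pos v else if anchor v is Some a then limit_pos a else 0.

Lemma affine_limit_pos v : v \in core -> affine_pt (limit_pos v) = L v.
Proof. by move=> /core_finite/eqP; rewrite /affine_pt /limit_pos /=; case: (L v) => [[a b] c] /= ->. Qed.

(** A triangle with vertices outside of the core meets a single piece, and all
    its redrawn vertices lie on the line of [component_line] (or they coincide, if
    the piece has no neighbour in the core). *)
Lemma redraw_area i :
  if [forall k, D i k \in core] then area2 (fun k => redraw (D i k)) = w i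
  else area2 (fun k => redraw (D i k)) = 0.
Proof.
case: ifP => [/forallP hO|/negbT].
  rewrite area2_det3 /redraw !hO !affine_limit_pos // L_det.
  by rewrite !(eqP (core_finite (hO _))) !mul1r.
rewrite negb_forall => /existsP[k kO]; set u := D i k in kO.
have conn x : x \notin core -> (exists l, x = D i l) -> connect piece_adj u x.
  by move=> xO [l xl]; apply: connect1; rewrite /piece_adj kO xO xl edge_face.
have anch x : x \notin core -> (exists l, x = D i l) -> anchor x = anchor u.
  move=> xO xl; apply: eq_pick => a; apply: eq_existsb => v; congr (_ && _).
  by rewrite (same_connect piece_adj_sym (conn _ xO xl)).
have mix x : x \in core -> (exists l, x = D i l) -> interface x u.
  by move=> xO [l xl]; rewrite /interface xO kO xl edge_face.
rewrite area2_det3.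
case anu : (anchor u) => [a|]; last first.
  have all0 l : redraw (D i l) = 0.
    rewrite /redraw; case: ifP => [lO|/negbT lO].
      move: anu; rewrite /anchor; case: pickP => // /(_ (D i l)) /existsP[].
      by exists u; rewrite mix ?connect0 //; exists l.
    by rewrite anch ?anu //; exists l.
  by rewrite !all0 /det3 /dot /join /=; ring.
have [u' /andP[mau uu']] : exists u', interface a u' && connect piece_adj u u'.
  by move: anu; rewrite /anchor; case: pickP => // x /existsP h [<-].
have l0 := interface_join_neq0 mau.
have aO : a \in core by case/and3P: mau.
suff on_line l : dot (join (L a) (L u')) (affine_pt (redraw (D i l))) = 0.
  by apply: (collinear_det3 l0).
rewrite /redraw; case: ifP => [lO|/negbT lO].
  rewrite affine_limit_pos //; apply: (component_line mau (u := u)); first by apply: mix => //; exists l.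
  by rewrite piece_adj_sym.
by rewrite anch ?anu //; [rewrite affine_limit_pos // dot_joinl | exists l].
Qed.

End Redraw.

(** * Points of the area variety *)

Theorem theorem3 (R : realType) (m n : nat) (T : square_triangulation R m n)
    (w : 'rV[R[i]]_n) (hw : area_variety T w) :
  area_image T w \/
  exists S : {set 'I_n},
    (exists2 i, i \in S & w 0 i != 0) /\ \sum_(i in S) w 0 i = 0.
Proof.
have w0 : w != 0.
  have [] := hw [set u : 'rV[R[i]]_n | u != 0 /\ forall f, set0 f -> mpoly.meval (u 0) f = 0]%classic.
  - by exists set0%classic; split.
  - by move=> u [u0 _]; split.
  - by [].
have two0 : 2 != 0 :> R[i] by rewrite pnatr_eq0.
set s := \sum_i w 0 i.
have [s0|s0] := eqVneq s 0.
  right; exists [set: 'I_n]%SET; split; last first.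
    by rewrite -[RHS]s0; apply: eq_bigl => i; rewrite inE.
  apply: contrapT => h; move/eqP: w0; apply; apply/rowP => i; rewrite mxE.
  by apply/eqP/negPn/negP => hi; apply: h; exists i.
have [L [Lfin [Lp Lq Lr Ls] Ldet]] := limit_drawing hw s0.
have Lc v : v \in [:: cp T; cq T; cr T; cs T] -> (L v).1.1 = 1.
  by rewrite !inE => /or4P[] /eqP ->; rewrite ?Lp ?Lq ?Lr ?Ls.
pose rho := redraw T L.
have rhoc v : v \in [:: cp T; cq T; cr T; cs T] -> rho v = ((L v).1.2, (L v).2).
  by move=> hv; rewrite /rho /redraw (core_corner Lc hv).
have rp : rho (cp T) = (0, 0) by rewrite rhoc ?Lp ?inE ?eqxx.
have rq : rho (cq T) = (1, 0) by rewrite rhoc ?Lq ?inE ?eqxx ?orbT.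
have rr : rho (cr T) = (1, 1) by rewrite rhoc ?Lr ?inE ?eqxx ?orbT.
have rs : rho (cs T) = (0, 1) by rewrite rhoc ?Ls ?inE ?eqxx ?orbT.
pose S := [set i | ~~ [forall k, Delta T i k \in core T L]]%SET.
have area := redraw_area Lfin Ldet Lc.
have areaS i : i \in S -> area2 (fun k => rho (Delta T i k)) = 0.
  by rewrite inE => /negbTE iS; have := area i; rewrite iS.
have areaN i : i \notin S -> area2 (fun k => rho (Delta T i k)) = 2 / s * w 0 i.
  by rewrite inE negbK => iS; have := area i; rewrite iS.
have total : \sum_i area2 (fun k => rho (Delta T i k)) = 2.
  by rewrite area2_sum !big_cons big_nil /= rp rq rr rs /cross /=; ring.
have sumS : \sum_(i in S) w 0 i = 0.
  move: total; rewrite (bigID (fun i => i \in S)) /= big1 // add0r.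
  rewrite (eq_bigr _ areaN) -mulr_sumr => e.
  have {}e : \sum_(i | i \notin S) w 0 i = s.
    apply: (mulfI (mulf_neq0 two0 (invr_neq0 s0))); rewrite e mulfVK //.
  have : s = s by []. rewrite {1}/s (bigID (fun i => i \in S)) /= e.
  by move/eqP; rewrite -subr_eq0 addrK => /eqP.
have [hS|hS] := pselect (exists2 i, i \in S & w 0 i != 0).
  by right; exists S.
left; split => //; exists rho; split.
  by rewrite /drawing rp rq rr rs; congr (_, _); rewrite /= ?(add0r, addr0).
exists s => //; apply/rowP => i; rewrite !mxE area_area2.
have [iS|iS] := boolP (i \in S).
  rewrite areaS // !mulr0; apply/eqP/negPn/negP => hi.
  by apply: hS; exists i.
by rewrite areaN //; field.
Qed.
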